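(* Let $p$ be a prime and let $f\colon X\to Y$ be a formally smooth morphism of locally Noetherian $F$-finite $\mathbf{F}_p$-schemes. Then for any $x\in X$ and any affine open neighborhood $V\subset Y$ of $f(x)$, there exist an integer $n\ge 0$, an affine open neighborhood $U\subset X$ of $x$ with $f(U)\subset V$, and a formally étale morphism $g\colon U\to \mathbf{A}^n_V$ such that the composition of $g$ with the canonical projection $\mathbf{A}^n_V\to V$ equals the restriction $f|_U\colon U\to V$.
   Context: An $\mathbf{F}_p$-scheme is $F$-finite if its absolute Frobenius morphism (identity on the underlying space, $p$-th power on the structure sheaf) is a finite morphism. Formally smooth and formally étale are meant in the usual sense (lifting, respectively unique lifting, along square-zero thickenings of affine schemes). *)

(* Defs.v *)
From HB Require Import structures.
From mathcomp Require Import all_boot all_order all_algebra.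
From mathcomp Require Import all_classical topology.
From mathcomp Require Import ring.
(* The notations of mpoly clash with those of mathcomp.classical. *)
From mathcomp Require Import -(notations) mpoly.

Set Implicit Arguments.
Unset Strict Implicit.
Unset Printing Implicit Defensive.

Import GRing.Theory.

Local Open Scope classical_set_scope.
Local Open Scope ring_scope.
Local Open Scope quotient_scope.

Section PrimeSpectrum.
Variable A : comPzRingType.

Definition prime_ideal (P : A -> Prop) : Prop :=
  [/\ P 0, forall a b, P a -> P b -> P (a + b), forall a b, P b -> P (a * b),
      ~ P 1 & forall a b, P (a * b) -> P a \/ P b].

Record spec : Type := Prime { pset :> A -> Prop; pset_prime : prime_ideal pset }.

HB.instance Definition _ := gen_eqMixin spec.
HB.instance Definition _ := gen_choiceMixin spec.

Definition zariski_open (U : set spec) : Prop :=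
  exists E : set A, U = [set p | exists2 a, E a & ~ p a].

Fact zariski_openT : zariski_open setT.
Proof.
exists [set 1]; apply/seteqP; split=> // p _ /=.
by exists 1 => //; case: (pset_prime p).
Qed.

Fact zariski_openI : setI_closed zariski_open.
Proof.
move=> _ _ [E ->] [F ->].
exists [set c | exists a b, [/\ E a, F b & c = a * b]].
apply/seteqP; split=> p /=.
  case=> -[a Ea pa] [b Fb pb]; exists (a * b); first by exists a, b.
  by case: (pset_prime p) => _ _ _ _ h /h [].
case=> _ [a [b [Ea Fb ->]]] pab; have [_ _ pM _ _] := pset_prime p.
split; [exists a|exists b] => // h; apply: pab; last exact: pM.
by rewrite mulrC; apply: pM.
Qed.

Fact zariski_open_bigU (I : Type) (f : I -> set spec) :
  (forall i, zariski_open (f i)) -> zariski_open (\bigcup_i f i).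
Proof.
move=> h; exists [set a | exists i, forall p : spec, ~ p a -> f i p].
apply/seteqP; split=> p /=.
  case=> i _ fip; have [E fE] := h i; move: (fip); rewrite fE => -[a Ea pa].
  by exists a => //; exists i => q qa; rewrite fE; exists a.
by case=> a [i hi] pa; exists i => //; apply: hi.
Qed.

HB.instance Definition _ := isOpenTopological.Build spec
  zariski_openT zariski_openI zariski_open_bigU.

Lemma spec_openE (U : set spec) : open U <-> zariski_open U.
Proof. by []. Qed.

Section Localization.
Variable p : spec.

Record ratio : Type := Ratio { num : A; den : A; den_notin : ~ p den }.

HB.instance Definition _ := gen_eqMixin ratio.
HB.instance Definition _ := gen_choiceMixin ratio.

(* loc is the local ring A_p, the localization of A at the complement of p. *)
Definition ratio_eq : rel ratio := fun x y =>
  `[< exists2 u, ~ p u & u * (num x * den y - num y * den x) = 0 >].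

Lemma notin1 : ~ p 1. Proof. by case: (pset_prime p). Qed.

Lemma notinM a b : ~ p a -> ~ p b -> ~ p (a * b).
Proof. by case: (pset_prime p) => _ _ _ _ h pa pb /h []. Qed.

Fact ratio_eq_equiv : equiv_class_of ratio_eq.
Proof.
split=> [x|x y|y x z].
- by apply/asboolP; exists 1; [exact: notin1|ring].
- apply/asbool_equiv_eq; split=> -[u pu h]; exists u => //;
  by rewrite -[LHS]opprK -mulrN opprB h oppr0.
- move=> /asboolP[u pu hu] /asboolP[v pv hv]; apply/asboolP.
  exists (u * v * den y); first by do 2?apply: notinM => //; apply: den_notin.
  transitivity (v * den z * (u * (num x * den y - num y * den x)) +
                u * den x * (v * (num y * den z - num z * den y))); first ring.
  by rewrite hu hv; ring.
Qed.

Canonical ratio_eq_equivRel := EquivRelPack ratio_eq_equiv.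


Definition loc : Type := {eq_quot ratio_eq}.

HB.instance Definition _ : EqQuotient _ ratio_eq loc := EqQuotient.on loc.
HB.instance Definition _ := Choice.on loc.

Definition frac (a b : A) (pb : ~ p b) : loc := \pi_loc (Ratio a pb).

Lemma frac_eq a b (pb : ~ p b) c d (pd : ~ p d) :
  frac a pb = frac c pd <-> exists2 u, ~ p u & u * (a * d - c * b) = 0.
Proof.
have e : reflect (frac a pb = frac c pd) _ :=
  eqmodP ratio_eq_equivRel (Ratio a pb) (Ratio c pd).
by split=> [/e/asboolP|h]; last by apply/e/asboolP.
Qed.

Lemma frac_surj (x : loc) : exists a b (pb : ~ p b), x = frac a pb.
Proof.
by elim/quotW: x => -[a b pb]; exists a, b, pb.
Qed.

Let add_ratio (x y : ratio) : ratio :=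
  Ratio (num x * den y + num y * den x) (notinM (@den_notin x) (@den_notin y)).
Let mul_ratio (x y : ratio) : ratio :=
  Ratio (num x * num y) (notinM (@den_notin x) (@den_notin y)).
Let opp_ratio (x : ratio) : ratio := Ratio (- num x) (@den_notin x).

Let loc_add (x y : loc) : loc := \pi_loc (add_ratio (repr x) (repr y)).
Let loc_mul (x y : loc) : loc := \pi_loc (mul_ratio (repr x) (repr y)).
Let loc_opp (x : loc) : loc := \pi_loc (opp_ratio (repr x)).

Let reprP (x : ratio) : exists2 u, ~ p u &
  u * (num (repr (\pi_loc x)) * den x - num x * den (repr (\pi_loc x))) = 0.
Proof.
have e : reflect (\pi_loc (repr (\pi_loc x)) = \pi_loc x) _ :=
  eqmodP ratio_eq_equivRel _ _.
by apply/asboolP/e; rewrite reprK.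
Qed.

Let loc_addE a b (pb : ~ p b) c d (pd : ~ p d) :
  loc_add (frac a pb) (frac c pd) = frac (a * d + c * b) (notinM pb pd).
Proof.
apply/frac_eq => /=; rewrite /frac.
have [u pu /= hu] := reprP (Ratio a pb); have [v pv /= hv] := reprP (Ratio c pd).
move: (repr (\pi_loc (Ratio a pb))) (repr (\pi_loc (Ratio c pd))) hu hv => x y.
move=> hu hv.
exists (u * v); first exact: notinM.
transitivity (v * d * den y * (u * (num x * b - a * den x)) +
   u * b * den x * (v * (num y * d - c * den y))); first by ring.
by rewrite hu hv; ring.
Qed.

Let loc_mulE a b (pb : ~ p b) c d (pd : ~ p d) :
  loc_mul (frac a pb) (frac c pd) = frac (a * c) (notinM pb pd).
Proof.
apply/frac_eq => /=; rewrite /frac.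
have [u pu /= hu] := reprP (Ratio a pb); have [v pv /= hv] := reprP (Ratio c pd).
move: (repr (\pi_loc (Ratio a pb))) (repr (\pi_loc (Ratio c pd))) hu hv => x y.
move=> hu hv.
exists (u * v); first exact: notinM.
transitivity (v * d * num y * (u * (num x * b - a * den x)) +
   u * a * den x * (v * (num y * d - c * den y))); first by ring.
by rewrite hu hv; ring.
Qed.

Let loc_oppE a b (pb : ~ p b) : loc_opp (frac a pb) = frac (- a) pb.
Proof.
apply/frac_eq => /=; rewrite /frac.
have [u pu /= hu] := reprP (Ratio a pb).
move: (repr (\pi_loc (Ratio a pb))) hu => x hu; exists u => //.
transitivity (- (u * (num x * b - a * den x))); first by ring.
by rewrite hu oppr0.
Qed.

Let frac_ring a b (pb : ~ p b) c d (pd : ~ p d) :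
  a * d = c * b -> frac a pb = frac c pd.
Proof.
by move=> h; apply/frac_eq; exists 1; [exact: notin1|rewrite h subrr mulr0].
Qed.

Let loc_zero : loc := frac 0 notin1.
Let loc_one : loc := frac 1 notin1.

Fact loc_addA : associative loc_add.
Proof.
move=> x y z; have [a [b [pb ->]]] := frac_surj x.
have [c [d [pd ->]]] := frac_surj y; have [e [f [pf ->]]] := frac_surj z.
by rewrite !loc_addE; apply: frac_ring; ring.
Qed.

Fact loc_addC : commutative loc_add.
Proof.
move=> x y; have [a [b [pb ->]]] := frac_surj x.
have [c [d [pd ->]]] := frac_surj y.
by rewrite !loc_addE; apply: frac_ring; ring.
Qed.

Fact loc_add0 : left_id loc_zero loc_add.
Proof.
move=> x; have [a [b [pb ->]]] := frac_surj x.
by rewrite loc_addE; apply: frac_ring; ring.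
Qed.

Fact loc_addN : left_inverse loc_zero loc_opp loc_add.
Proof.
move=> x; have [a [b [pb ->]]] := frac_surj x.
by rewrite loc_oppE loc_addE; apply: frac_ring; ring.
Qed.

Fact loc_mulA : associative loc_mul.
Proof.
move=> x y z; have [a [b [pb ->]]] := frac_surj x.
have [c [d [pd ->]]] := frac_surj y; have [e [f [pf ->]]] := frac_surj z.
by rewrite !loc_mulE; apply: frac_ring; ring.
Qed.

Fact loc_mulC : commutative loc_mul.
Proof.
move=> x y; have [a [b [pb ->]]] := frac_surj x.
have [c [d [pd ->]]] := frac_surj y.
by rewrite !loc_mulE; apply: frac_ring; ring.
Qed.

Fact loc_mul1 : left_id loc_one loc_mul.
Proof.
move=> x; have [a [b [pb ->]]] := frac_surj x.
by rewrite loc_mulE; apply: frac_ring; ring.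
Qed.

Fact loc_mulDl : left_distributive loc_mul loc_add.
Proof.
move=> x y z; have [a [b [pb ->]]] := frac_surj x.
have [c [d [pd ->]]] := frac_surj y; have [e [f [pf ->]]] := frac_surj z.
by rewrite !(loc_addE, loc_mulE); apply: frac_ring; ring.
Qed.

HB.instance Definition _ :=
  GRing.isZmodule.Build loc loc_addA loc_addC loc_add0 loc_addN.
HB.instance Definition _ :=
  GRing.Zmodule_isComPzRing.Build loc loc_mulA loc_mulC loc_mul1 loc_mulDl.

Lemma fracD a b (pb : ~ p b) c d (pd : ~ p d) :
  frac a pb + frac c pd = frac (a * d + c * b) (notinM pb pd).
Proof. exact: loc_addE. Qed.

Lemma fracM a b (pb : ~ p b) c d (pd : ~ p d) :
  frac a pb * frac c pd = frac (a * c) (notinM pb pd).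
Proof. exact: loc_mulE. Qed.

Lemma fracN a b (pb : ~ p b) : - frac a pb = frac (- a) pb.
Proof. exact: loc_oppE. Qed.

Lemma frac0 : 0 = frac 0 notin1. Proof. by []. Qed.
Lemma frac1 : 1 = frac 1 notin1. Proof. by []. Qed.

Lemma frac_eq_mul a b (pb : ~ p b) c d (pd : ~ p d) :
  a * d = c * b -> frac a pb = frac c pd.
Proof. exact: frac_ring. Qed.

Lemma frac_unit a b (pb : ~ p b) (y : loc) : frac a pb * y = 1 -> ~ p a.
Proof.
have [c [d [pd ->]]] := frac_surj y; rewrite fracM frac1.
move=> /frac_eq[u pu]; rewrite mulr1 mul1r => /eqP.
rewrite mulrBr subr_eq0 => /eqP h pa.
have [_ _ pM _ _] := pset_prime p; apply: (notinM pu (notinM pb pd)).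
by rewrite -h (mulrC a); do 2!apply: (pM).
Qed.

End Localization.
End PrimeSpectrum.

Record opens (X : topologicalType) : Type :=
  Opens { oset :> X -> Prop; oset_open : open oset }.

Definition preim_opens (X Y : topologicalType) (f : X -> Y)
    (fc : continuous f) (V : opens Y) : opens X :=
  Opens (proj1 (@continuousP _ _ f) fc V (oset_open V)).

Lemma opens_val_open (X : topologicalType) (U : opens X)
  (W : opens (set_type U)) : open (set_val @` W).
Proof.
have [V oV VW] := oset_open W.
suff -> : set_val @` W = V `&` U by apply: openI => //; apply: oset_open.
apply/seteqP; split=> x.
  case=> y; rewrite -VW => Vy <-; split=> //.
  exact: set_mem (valP y).
case=> Vx Ux; exists (SigSub (mem_set Ux)) => //.
by rewrite -VW.
Qed.

Definition opens_val (X : topologicalType) (U : opens X)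
    (W : opens (set_type U)) : opens X :=
  Opens (opens_val_open W).

(* The sheaf axioms are stated for families indexed by an arbitrary type;
   agreement on overlaps is stated on every open subset of an overlap. *)
Record ringed_space : Type := RingedSpace {
  points :> topologicalType;
  sec : opens points -> comPzRingType;
  res : forall U V : opens points, (V : set points) `<=` U ->
    {rmorphism sec U -> sec V};
  res_id : forall (U : opens points) (h : (U : set points) `<=` U) (s : sec U),
    res h s = s;
  res_comp : forall (U V W : opens points) (hV : (V : set points) `<=` U)
    (hW : (W : set points) `<=` V) (hWU : (W : set points) `<=` U) (s : sec U),
    res hW (res hV s) = res hWU s;
  res_inj : forall (I : Type) (U : opens points) (V : I -> opens points)
    (hV : forall i, (V i : set points) `<=` U),
    (U : set points) `<=` \bigcup_i V i ->
    forall s t : sec U, (forall i, res (hV i) s = res (hV i) t) -> s = t;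
  res_glue : forall (I : Type) (U : opens points) (V : I -> opens points)
    (hV : forall i, (V i : set points) `<=` U),
    (U : set points) `<=` \bigcup_i V i ->
    forall s : (forall i, sec (V i)),
    (forall i j (W : opens points) (hi : (W : set points) `<=` V i)
      (hj : (W : set points) `<=` V j), res hi (s i) = res hj (s j)) ->
    exists t : sec U, forall i, res (hV i) t = s i }.

(* The germ of s is a unit of the stalk at x (a unit of the stalk is the same
   as a section invertible on some neighborhood of x). *)
Definition germ_unit (X : ringed_space) (x : X) (U : opens X) (s : sec U) :=
  exists (W : opens X) (h : (W : set X) `<=` U),
    W x /\ exists t : sec W, res h s * t = 1.

(* Morphisms of locally ringed spaces: germ_local says that the maps induced
   on stalks are local. *)
Record morphism (X Y : ringed_space) : Type := Morphism {
  base :> X -> Y;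
  base_cont : continuous base;
  comorph : forall V : opens Y,
    {rmorphism sec V -> sec (preim_opens base_cont V)};
  comorph_res : forall (V W : opens Y) (h : (W : set Y) `<=` V)
    (h' : (preim_opens base_cont W : set X) `<=` preim_opens base_cont V)
    (s : sec V), comorph W (res h s) = res h' (comorph V s);
  germ_local : forall (x : X) (V : opens Y) (s : sec V), V (base x) ->
    germ_unit x (comorph V s) -> germ_unit (base x) s }.

Definition preim_mor (X Y : ringed_space) (f : morphism X Y) (V : opens Y) :
  opens X := preim_opens (@base_cont _ _ f) V.

(* Equality of morphisms: same map on points, and the comorphisms agree on
   every open contained in the (equal) preimages. *)
Definition eq_mor (X Y : ringed_space) (f g : morphism X Y) : Prop :=
  (forall x, f x = g x) /\
  forall (V : opens Y) (W : opens X) (hf : (W : set X) `<=` preim_mor f V)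
    (hg : (W : set X) `<=` preim_mor g V) (s : sec V),
    res hf (comorph f V s) = res hg (comorph g V s).

Section IdComp.

Section Id.
Variable X : ringed_space.

Fact idfun_cont : continuous (@idfun X). Proof. by move=> x. Qed.

Fact idfun_sub (V : opens X) : (preim_opens idfun_cont V : set X) `<=` V.
Proof. by []. Qed.

Fact id_comorph_res (V W : opens X) (h : (W : set X) `<=` V)
    (h' : (preim_opens idfun_cont W : set X) `<=` preim_opens idfun_cont V)
    (s : sec V) : res (@idfun_sub W) (res h s) = res h' (res (@idfun_sub V) s).
Proof. by rewrite !(res_comp _ _ (subset_trans h' (@idfun_sub V))). Qed.

Fact id_local (x : X) (V : opens X) (s : sec V) : V x ->
  germ_unit x (res (@idfun_sub V) s) -> germ_unit x s.
Proof.
move=> Vx [W [h [Wx [t ht]]]]; exists W, h; split=> //; exists t.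
by rewrite -ht (@res_comp X V _ _ _ _ h).
Qed.

Definition id_mor : morphism X X := Morphism id_comorph_res id_local.
End Id.

Section Comp.
Variables (X Y Z : ringed_space) (g : morphism Y Z) (f : morphism X Y).

Fact comp_cont : continuous (g \o f).
Proof. by move=> x; apply: continuous_comp; apply: base_cont. Qed.

Fact comp_sub (V : opens Z) :
  (preim_opens comp_cont V : set X) `<=` preim_mor f (preim_mor g V).
Proof. by []. Qed.

Definition comp_comorph (V : opens Z) :
    {rmorphism sec V -> sec (preim_opens comp_cont V)} :=
  res (@comp_sub V) \o (comorph f (preim_mor g V) \o comorph g V).

Fact comp_comorph_res (V W : opens Z) (h : (W : set Z) `<=` V)
    (h' : (preim_opens comp_cont W : set X) `<=` preim_opens comp_cont V)
    (s : sec V) : comp_comorph W (res h s) = res h' (comp_comorph V s).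
Proof.
have hg : (preim_mor g W : set Y) `<=` preim_mor g V by move=> y /h.
have hf : (preim_mor f (preim_mor g W) : set X) `<=` preim_mor f (preim_mor g V) by move=> y /h.
rewrite /= (comorph_res _ hg) (comorph_res _ hf).
by rewrite !(res_comp _ _ (subset_trans h' (@comp_sub V))).
Qed.

Fact comp_local (x : X) (V : opens Z) (s : sec V) : V (g (f x)) ->
  germ_unit x (comp_comorph V s) -> germ_unit (g (f x)) s.
Proof.
move=> Vx [W [h [Wx [t ht]]]]; apply: germ_local => //.
apply: germ_local => //; exists W, h; split=> //; exists t.
by rewrite -ht /= (@res_comp X (preim_mor f (preim_mor g V)) _ _ _ _ h).
Qed.

Definition comp_mor : morphism X Z := Morphism comp_comorph_res comp_local.
End Comp.
End IdComp.

Definition is_iso (X Y : ringed_space) (f : morphism X Y) : Prop :=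
  exists g : morphism Y X,
    eq_mor (comp_mor g f) (id_mor X) /\ eq_mor (comp_mor f g) (id_mor Y).

Section OpenSubspace.

Section Restrict.
Variables (X : ringed_space) (U : opens X).
Let pt : topologicalType := set_type U.

Fact opens_valS (V W : opens pt) :
  (W : set pt) `<=` V -> (opens_val W : set X) `<=` opens_val V.
Proof. by move=> h _ [x Wx <-]; exists x => //; apply: h. Qed.

Let rsec (W : opens pt) : comPzRingType := sec (opens_val W).
Let rres (V W : opens pt) (h : (W : set pt) `<=` V) :
  {rmorphism rsec V -> rsec W} := res (opens_valS h).

Fact restrict_res_id (V : opens pt) (h : (V : set pt) `<=` V) (s : rsec V) :
  rres h s = s.
Proof. exact: res_id. Qed.

Fact restrict_res_comp (V1 V2 V3 : opens pt) (h2 : (V2 : set pt) `<=` V1)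
    (h3 : (V3 : set pt) `<=` V2) (h31 : (V3 : set pt) `<=` V1) (s : rsec V1) :
  rres h3 (rres h2 s) = rres h31 s.
Proof. exact: res_comp. Qed.

Lemma opens_val_cover (I : Type) (W : opens pt) (V : I -> opens pt) :
  (W : set pt) `<=` \bigcup_i V i ->
  (opens_val W : set X) `<=` \bigcup_i opens_val (V i).
Proof.
by move=> h _ [x /h [i _ Vx] <-]; exists i => //; exists x.
Qed.

Fact restrict_res_inj (I : Type) (W : opens pt) (V : I -> opens pt)
    (hV : forall i, (V i : set pt) `<=` W) :
  (W : set pt) `<=` \bigcup_i V i ->
  forall s t : rsec W, (forall i, rres (hV i) s = rres (hV i) t) -> s = t.
Proof. by move=> /opens_val_cover; apply: res_inj. Qed.

Fact restrict_res_glue (I : Type) (W : opens pt) (V : I -> opens pt)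
    (hV : forall i, (V i : set pt) `<=` W) :
  (W : set pt) `<=` \bigcup_i V i ->
  forall s : (forall i, rsec (V i)),
  (forall i j (W' : opens pt) (hi : (W' : set pt) `<=` V i)
    (hj : (W' : set pt) `<=` V j), rres hi (s i) = rres hj (s j)) ->
  exists t : rsec W, forall i, rres (hV i) t = s i.
Proof.
move=> hW s hs.
apply: (@res_glue X I (opens_val W) (fun i => opens_val (V i))
  (fun i => opens_valS (hV i))) => [|i j W' hi hj].
  exact: opens_val_cover.
have oW : open (set_val @^-1` W' : set pt).
  by exists W' => //; apply: oset_open.
have sub k : (W' : set X) `<=` opens_val (V k) ->
    (Opens oW : set pt) `<=` V k.
  by move=> h x /= /h[y Vy /val_inj <-].
have hW' : (W' : set X) `<=` opens_val (Opens oW).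
  by move=> x W'x; have [y _ yx] := hi _ W'x; exists y; rewrite //= yx.
have := hs i j (Opens oW) (sub i hi) (sub j hj).
by move=> /(congr1 (res hW')); rewrite (res_comp _ _ hi) (res_comp _ _ hj).
Qed.

Definition open_subspace : ringed_space := RingedSpace restrict_res_id
  restrict_res_comp restrict_res_inj restrict_res_glue.
End Restrict.

Section RestrictMor.
Variables (X Y : ringed_space) (f : morphism X Y) (U : opens X) (V : opens Y).
Hypothesis fUV : forall x, U x -> V (f x).

Definition restrict_base (x : open_subspace U) : open_subspace V :=
  SigSub (mem_set (fUV (set_mem (valP x)))).

Fact restrict_cont : continuous restrict_base.
Proof.
apply/continuousP => _ [B oB <-].
exists (f @^-1` B) => //; apply: (proj1 (@continuousP _ _ f)) => //; exact: base_cont.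
Qed.

Fact restrict_sub (W : opens (open_subspace V)) :
  (opens_val (preim_opens restrict_cont W) : set X) `<=` preim_mor f (opens_val W).
Proof. by move=> _ [x /= Wx <-]; exists (restrict_base x). Qed.

Definition restrict_comorph (W : opens (open_subspace V)) :
    {rmorphism sec W -> sec (preim_opens restrict_cont W)} :=
  res (@restrict_sub W) \o comorph f (opens_val W).

Fact restrict_comorph_res (W1 W2 : opens (open_subspace V))
    (h : (W2 : set (open_subspace V)) `<=` W1)
    (h' : (preim_opens restrict_cont W2 : set (open_subspace U)) `<=`
          preim_opens restrict_cont W1) (s : sec W1) :
  restrict_comorph W2 (res h s) = res h' (restrict_comorph W1 s).
Proof.
have hf : (preim_mor f (opens_val W2) : set X) `<=` preim_mor f (opens_val W1).
  by move=> x; apply: opens_valS.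
rewrite /= (comorph_res _ hf).
by rewrite !(res_comp _ _ (subset_trans (@restrict_sub W2) hf)).
Qed.

Fact restrict_local (x : open_subspace U) (W : opens (open_subspace V)) (s : sec W) :
  W (restrict_base x) -> germ_unit x (restrict_comorph W s) ->
  germ_unit (restrict_base x) s.
Proof.
move=> Wx [W' [h [W'x [t ht]]]].
have Wfx : opens_val W (f (val x)) by exists (restrict_base x).
have : germ_unit (val x) (comorph f (opens_val W) s).
  have hW' := subset_trans (opens_valS h) (@restrict_sub W).
  exists (opens_val W'), hW'; split; first by exists x.
  by exists t; rewrite -ht /= (res_comp _ _ hW').
move=> /(germ_local Wfx) [W2 [h2 [W2x [t2 ht2]]]].
have oW2 : open (set_val @^-1` W2 : set (open_subspace V)).
  by exists W2 => //; apply: oset_open.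
have sub : (Opens oW2 : set (open_subspace V)) `<=` W.
  by move=> y /= /h2[z Wz /val_inj <-].
have sub2 : (opens_val (Opens oW2) : set Y) `<=` W2 by move=> _ [y /= ? <-].
exists (Opens oW2), sub; split=> //; exists (res sub2 t2).
transitivity (res sub2 (res h2 s * t2)); last by rewrite ht2 rmorph1.
by rewrite rmorphM /= (res_comp _ _ (opens_valS sub)).
Qed.

Definition restrict_mor : morphism (open_subspace U) (open_subspace V) :=
  Morphism restrict_comorph_res restrict_local.
End RestrictMor.
End OpenSubspace.

Section StructureSheaf.
Variable A : comPzRingType.

Section Sections.
Variable U : opens (spec A).

(* The structure sheaf of Spec A: sections over U are the families of elements
   of the A_p, for p in U, that are locally quotients of elements of A. *)
Definition germs : Type := forall p : spec A, U p -> loc p.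

HB.instance Definition _ := gen_eqMixin germs.
HB.instance Definition _ := gen_choiceMixin germs.

Fact germsP (s t : germs) : (forall p Up, s p Up = t p Up) -> s = t.
Proof. by move=> h; apply: functional_extensionality_dep => p; apply: funext. Qed.

Let germs_zero : germs := fun p _ => 0.
Let germs_one : germs := fun p _ => 1.
Let germs_add (s t : germs) : germs := fun p Up => s p Up + t p Up.
Let germs_mul (s t : germs) : germs := fun p Up => s p Up * t p Up.
Let germs_opp (s : germs) : germs := fun p Up => - s p Up.

Fact germs_addA : associative germs_add.
Proof. by move=> s t u; apply: germsP => p Up; apply: addrA. Qed.
Fact germs_addC : commutative germs_add.
Proof. by move=> s t; apply: germsP => p Up; apply: addrC. Qed.
Fact germs_add0 : left_id germs_zero germs_add.
Proof. by move=> s; apply: germsP => p Up; apply: add0r. Qed.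
Fact germs_addN : left_inverse germs_zero germs_opp germs_add.
Proof. by move=> s; apply: germsP => p Up; apply: addNr. Qed.
Fact germs_mulA : associative germs_mul.
Proof. by move=> s t u; apply: germsP => p Up; apply: mulrA. Qed.
Fact germs_mulC : commutative germs_mul.
Proof. by move=> s t; apply: germsP => p Up; apply: mulrC. Qed.
Fact germs_mul1 : left_id germs_one germs_mul.
Proof. by move=> s; apply: germsP => p Up; apply: mul1r. Qed.
Fact germs_mulDl : left_distributive germs_mul germs_add.
Proof. by move=> s t u; apply: germsP => p Up; apply: mulrDl. Qed.

HB.instance Definition _ :=
  GRing.isZmodule.Build germs germs_addA germs_addC germs_add0 germs_addN.
HB.instance Definition _ := GRing.Zmodule_isComPzRing.Build germs
  germs_mulA germs_mulC germs_mul1 germs_mulDl.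

Definition locally_fraction (s : germs) : Prop :=
  forall p, U p -> exists (a b : A) (W : opens (spec A)), W p /\
    forall q (Wq : W q) (Uq : U q), exists qb : ~ q b, s q Uq = frac a qb.

Definition regular_germs : {pred germs} := fun s => `[< locally_fraction s >].

Lemma fracI (p : spec A) a b (pb pb' : ~ p b) : frac a pb = frac a pb'.
Proof. by congr frac; apply: Prop_irrelevance. Qed.

Fact opensI_open (V W : opens (spec A)) : open ((V : set (spec A)) `&` W).
Proof. by apply: openI; apply: oset_open. Qed.

Fact regular_subring : subring_closed regular_germs.
Proof.
split.
- apply/asboolP => p Up; exists 1, 1, U; split=> // q Wq Uq.
  by exists (@notin1 _ q).
- move=> s t /asboolP hs /asboolP ht; apply/asboolP => p Up.
  have [a [b [V [Vp hV]]]] := hs p Up; have [c [d [W [Wp hW]]]] := ht p Up.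
  exists (a * d - c * b), (b * d), (Opens (@opensI_open V W)).
  split=> // q [Vq Wq] Uq.
  have [qb eb] := hV q Vq Uq; have [qd ed] := hW q Wq Uq.
  exists (notinM qb qd); rewrite -mulNr -fracD -fracN -eb -ed //.
- move=> s t /asboolP hs /asboolP ht; apply/asboolP => p Up.
  have [a [b [V [Vp hV]]]] := hs p Up; have [c [d [W [Wp hW]]]] := ht p Up.
  exists (a * c), (b * d), (Opens (@opensI_open V W)).
  split=> // q [Vq Wq] Uq.
  have [qb eb] := hV q Vq Uq; have [qd ed] := hW q Wq Uq.
  by exists (notinM qb qd); rewrite -fracM -eb -ed.
Qed.

HB.instance Definition _ :=
  GRing.isSubringClosed.Build germs regular_germs regular_subring.

Record spec_sec : Type := SpecSec { sec_val : germs; _ : sec_val \in regular_germs }.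

HB.instance Definition _ := [isSub for sec_val].
HB.instance Definition _ := [Choice of spec_sec by <:].
HB.instance Definition _ := GRing.SubChoice_isSubComPzRing.Build germs regular_germs
  spec_sec (subringClosedP _).

Lemma spec_secP (s t : spec_sec) :
  (forall p Up, sec_val s Up = sec_val t Up :> loc p) -> s = t.
Proof. by move=> h; apply: val_inj; apply: germsP. Qed.

Lemma spec_sec_frac (s : spec_sec) : locally_fraction (sec_val s).
Proof. by case: s => s /= /asboolP. Qed.
End Sections.

Arguments regular_germs U : clear implicits.

Section Restriction.
Variables (U V : opens (spec A)) (h : (V : set (spec A)) `<=` U).

Definition res_germs (s : germs U) : germs V := fun p Vp => s p (h Vp).

Fact res_germs_regular (s : spec_sec U) : res_germs (sec_val s) \in regular_germs V.
Proof.
apply/asboolP => p Vp; have [a [b [W [Wp hW]]]] := spec_sec_frac s (h Vp).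
by exists a, b, W; split=> // q Wq Vq; apply: hW.
Qed.

Definition spec_res (s : spec_sec U) : spec_sec V :=
  SpecSec (res_germs_regular s).

Fact spec_res_zmod : zmod_morphism spec_res.
Proof. by move=> s t; apply: spec_secP. Qed.
Fact spec_res_monoid : monoid_morphism spec_res.
Proof. by split=> [|s t]; apply: spec_secP. Qed.

HB.instance Definition _ :=
  GRing.isZmodMorphism.Build (spec_sec U) (spec_sec V) spec_res spec_res_zmod.
HB.instance Definition _ :=
  GRing.isMonoidMorphism.Build (spec_sec U) (spec_sec V) spec_res
    spec_res_monoid.
End Restriction.

Let O (U : opens (spec A)) : comPzRingType := spec_sec U.
Let r (U V : opens (spec A)) (h : (V : set (spec A)) `<=` U) :
  {rmorphism O U -> O V} := spec_res h.

Fact spec_res_id (U : opens (spec A)) (h : (U : set (spec A)) `<=` U) (s : O U) :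
  r h s = s.
Proof.
by apply: spec_secP => p Up /=; rewrite /res_germs (Prop_irrelevance (h p Up) Up).
Qed.

Fact spec_res_comp (U V W : opens (spec A)) (hV : (V : set (spec A)) `<=` U)
    (hW : (W : set (spec A)) `<=` V) (hWU : (W : set (spec A)) `<=` U)
    (s : O U) : r hW (r hV s) = r hWU s.
Proof.
apply: spec_secP => p Wp /=; rewrite /res_germs.
by rewrite (Prop_irrelevance (hV p (hW p Wp)) (hWU p Wp)).
Qed.

Fact spec_res_inj (I : Type) (U : opens (spec A)) (V : I -> opens (spec A))
    (hV : forall i, (V i : set (spec A)) `<=` U) :
  (U : set (spec A)) `<=` \bigcup_i V i ->
  forall s t : O U, (forall i, r (hV i) s = r (hV i) t) -> s = t.
Proof.
move=> cover s t h; apply: spec_secP => p Up.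
have [i _ Vip] := cover p Up.
have := congr1 (fun s : spec_sec (V i) => sec_val s Vip) (h i).
by rewrite /= /res_germs (Prop_irrelevance (hV i p Vip) Up).
Qed.

Fact spec_res_glue (I : Type) (U : opens (spec A)) (V : I -> opens (spec A))
    (hV : forall i, (V i : set (spec A)) `<=` U) :
  (U : set (spec A)) `<=` \bigcup_i V i ->
  forall s : (forall i, O (V i)),
  (forall i j (W : opens (spec A)) (hi : (W : set (spec A)) `<=` V i)
    (hj : (W : set (spec A)) `<=` V j), r hi (s i) = r hj (s j)) ->
  exists t : O U, forall i, r (hV i) t = s i.
Proof.
move=> cover s hs.
have ex p (Up : U p) : exists i, V i p by have [i _] := cover p Up; exists i.
pose ix p (Up : U p) := sval (cid (ex p Up)).
have ixP p (Up : U p) : V (ix p Up) p by rewrite /ix; case: cid.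
pose t : germs U := fun p Up => sec_val (s (ix p Up)) (ixP p Up).
have tE i p (Vp : V i p) (Up : U p) : t p Up = sec_val (s i) Vp.
  rewrite /t; move: (ix p Up) (ixP p Up) => j Vjp.
  pose W := Opens (@opensI_open (V i) (V j)).
  have hi : (W : set (spec A)) `<=` V i by move=> q [].
  have hj : (W : set (spec A)) `<=` V j by move=> q [].
  have Wp : W p by [].
  have := congr1 (fun s : spec_sec W => sec_val s Wp) (hs i j W hi hj).
  rewrite /= /res_germs (Prop_irrelevance (hi p Wp) Vp).
  by rewrite (Prop_irrelevance (hj p Wp) Vjp).
have treg : t \in regular_germs U.
  apply/asboolP => p Up; have [i _ Vip] := cover p Up.
  have [a [b [W [Wp hW]]]] := spec_sec_frac (s i) Vip.
  exists a, b, (Opens (@opensI_open W (V i))); split=> // q [Wq Viq] Uq.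
  by have [qb e] := hW q Wq Viq; exists qb; rewrite (tE i q Viq).
exists (SpecSec treg) => i; apply: spec_secP => p Vip /=.
by rewrite /res_germs (tE i p Vip).
Qed.

Definition Spec : ringed_space :=
  RingedSpace spec_res_id spec_res_comp spec_res_inj spec_res_glue.
End StructureSheaf.

Arguments regular_germs {A} U _.

Section SpecMap.
Variables (A B : comPzRingType) (phi : {rmorphism A -> B}).

Fact contract_prime (p : spec B) : prime_ideal (fun a => p (phi a)).
Proof.
have [p0 pD pM p1 pP] := pset_prime p; split.
- by rewrite rmorph0.
- by move=> a b pa pb; rewrite rmorphD; apply: pD.
- by move=> a b pb; rewrite rmorphM; apply: pM.
- by rewrite rmorph1.
- by move=> a b; rewrite rmorphM; apply: pP.
Qed.

Definition contract (p : spec B) : spec A := Prime (contract_prime p).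

Fact contract_cont : continuous contract.
Proof.
apply/continuousP => _ [E ->]; exists (phi @` E); apply/seteqP; split=> p /=.
  by case=> a Ea pa; exists (phi a) => //; exists a.
by case=> _ [a Ea <-] pa; exists a.
Qed.

Section LocMap.
Variable p : spec B.

Definition loc_map (x : loc (contract p)) : loc p :=
  @frac B p (phi (num (repr x))) (phi (den (repr x))) (@den_notin _ _ (repr x)).

Lemma loc_map_frac a b (pb : ~ contract p b) :
  loc_map (frac a pb) = @frac B p (phi a) (phi b) pb.
Proof.
rewrite /loc_map; move: (repr _) (reprK (frac a pb)) => -[c d pd] /= h.
have [u pu hu] := proj1 (@frac_eq A (contract p) c d pd a b pb) h.
apply/frac_eq; exists (phi u) => //.
by rewrite -!rmorphM -rmorphB -rmorphM hu rmorph0.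
Qed.

Fact loc_map_zmod : zmod_morphism loc_map.
Proof.
move=> x y; have [a [b [pb ->]]] := frac_surj x.
have [c [d [pd ->]]] := frac_surj y.
rewrite fracN fracD !loc_map_frac fracN fracD; apply: frac_eq_mul.
by rewrite !(rmorphD, rmorphM, rmorphN).
Qed.

Fact loc_map_monoid : monoid_morphism loc_map.
Proof.
split=> [|x y].
  by rewrite frac1 loc_map_frac frac1; apply: frac_eq_mul; rewrite rmorph1.
have [a [b [pb ->]]] := frac_surj x; have [c [d [pd ->]]] := frac_surj y.
rewrite fracM !loc_map_frac fracM; apply: frac_eq_mul.
by rewrite !rmorphM.
Qed.

HB.instance Definition _ :=
  GRing.isZmodMorphism.Build (loc (contract p)) (loc p) loc_map loc_map_zmod.
HB.instance Definition _ :=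
  GRing.isMonoidMorphism.Build (loc (contract p)) (loc p) loc_map
    loc_map_monoid.
End LocMap.

Section Comorphism.
Variable V : opens (spec A).
Let U : opens (spec B) := preim_opens contract_cont V.

Definition germs_map (s : germs V) : germs U :=
  fun p Up => loc_map (s (contract p) Up).

Fact germs_map_regular (s : spec_sec V) : germs_map (sec_val s) \in regular_germs U.
Proof.
apply/asboolP => p Up; have [a [b [W [Wp hW]]]] := spec_sec_frac s Up.
exists (phi a), (phi b), (preim_opens contract_cont W); split=> // q Wq Uq.
have [qb e] := hW (contract q) Wq Uq; exists qb.
by rewrite /germs_map e loc_map_frac.
Qed.

Definition sec_map (s : spec_sec V) : spec_sec U :=
  SpecSec (germs_map_regular s).

Fact sec_map_zmod : zmod_morphism sec_map.
Proof. by move=> s t; apply: spec_secP => p Up; apply: loc_map_zmod. Qed.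
Fact sec_map_monoid : monoid_morphism sec_map.
Proof.
by split=> [|s t]; apply: spec_secP => p Up;
  [exact: (rmorph1 (@loc_map p))|exact: (rmorphM (@loc_map p))].
Qed.

HB.instance Definition _ :=
  GRing.isZmodMorphism.Build (spec_sec V) (spec_sec U) sec_map sec_map_zmod.
HB.instance Definition _ :=
  GRing.isMonoidMorphism.Build (spec_sec V) (spec_sec U) sec_map sec_map_monoid.
End Comorphism.

Let comap (V : opens (Spec A)) :
  {rmorphism sec V -> @sec (Spec B) (preim_opens contract_cont V)} :=
  @sec_map V.

Fact sec_map_res (V W : opens (Spec A)) (h : (W : set (Spec A)) `<=` V)
    (h' : (preim_opens contract_cont W : set (Spec B)) `<=`
          preim_opens contract_cont V) (s : sec V) :
  comap W (res h s) = @res (Spec B) _ _ h' (comap V s).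
Proof.
apply: spec_secP => p Wp /=; rewrite /germs_map /= /res_germs /=.
by rewrite /germs_map (Prop_irrelevance (h (contract p) Wp) (h' p Wp)).
Qed.

Fact sec_map_local (p : Spec B) (V : opens (Spec A)) (s : sec V) :
  V (contract p) -> germ_unit p (comap V s) ->
  @germ_unit (Spec A) (contract p) V s.
Proof.
move=> Vp [W [h [Wp [t ht]]]].
have [a [b [W' [W'p hW']]]] := spec_sec_frac s Vp.
have pa : ~ p (phi a).
  have e : @loc_map p (sec_val s (h p Wp)) * sec_val t Wp = 1 :=
    congr1 (fun s : spec_sec W => sec_val s Wp) ht.
  have [pb es] := hW' _ W'p (h p Wp).
  by move: e; rewrite es loc_map_frac; apply: frac_unit.
pose N := [set q : spec A | [/\ W' q, V q & ~ q a]].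
have oN : open N.
  have -> : N = (W' : set (spec A)) `&` V `&` [set q | exists2 c, c = a & ~ q c].
    apply/seteqP; split=> q /=; first by move=> [? ? ?]; split=> //; exists a.
    by move=> [[? ?] [_ ->]].
  apply: openI; first by apply: openI; apply: oset_open.
  by exists [set a].
pose NO : opens (spec A) := Opens oN.
have hN : (NO : set (spec A)) `<=` V by move=> q [].
pose t' : germs NO := fun q Nq => let: And3 _ _ qa := Nq in frac b qa.
have t'reg : t' \in regular_germs NO.
  apply/asboolP => q Nq; exists b, a, NO; split=> // q' Nq' Nq''.
  by exists (let: And3 _ _ qa := Nq'' in qa); rewrite /t'; case: (Nq'').
exists NO, hN; split; first by [].
exists (SpecSec t'reg : spec_sec NO); apply: spec_secP => q Nq.
suff : sec_val s (hN q Nq) * t' q Nq = 1 by [].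
have [W'q Vq qa] := Nq; have [qb ->] := hW' _ W'q (hN q Nq).
have -> : t' q Nq = frac b qa.
  by rewrite /t'; case: Nq => ? ? qa'; apply: fracI.
by rewrite fracM frac1; apply: frac_eq_mul; ring.
Qed.

Definition Spec_map : morphism (Spec B) (Spec A) :=
  @Morphism (Spec B) (Spec A) contract contract_cont comap sec_map_res
    sec_map_local.
End SpecMap.

Definition is_affine (X : ringed_space) : Prop :=
  exists (A : comPzRingType) (f : morphism X (Spec A)), is_iso f.

Definition affine_open (X : ringed_space) (U : opens X) : Prop :=
  is_affine (open_subspace U).

(* Stalks of such an X are local rings, being those of the Spec A. *)
Definition is_scheme (X : ringed_space) : Prop :=
  forall x : X, exists2 U : opens X, U x & affine_open U.

Definition noetherian (A : comPzRingType) : Prop :=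
  forall I : A -> Prop,
    [/\ I 0, forall a b, I a -> I b -> I (a + b) &
        forall a b, I b -> I (a * b)] ->
    exists (n : nat) (g : 'I_n -> A), (forall i, I (g i)) /\
      forall a, I a -> exists c : 'I_n -> A, a = \sum_i c i * g i.

Definition locally_noetherian (X : ringed_space) : Prop :=
  forall x : X, exists U : opens X, [/\ U x, affine_open U & noetherian (sec U)].

Definition module_finite (A B : comPzRingType) (phi : {rmorphism A -> B}) :=
  exists (n : nat) (b : 'I_n -> B),
    forall y, exists a : 'I_n -> A, y = \sum_i phi (a i) * b i.

Definition finite_morphism (X Y : ringed_space) (f : morphism X Y) : Prop :=
  forall y : Y, exists V : opens Y, [/\ V y, affine_open V,
    affine_open (preim_mor f V) & module_finite (comorph f V)].

Lemma exprD_char (A : comPzRingType) (p : nat) (s t : A) :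
  prime p -> p%:R = 0 :> A -> (s + t) ^+ p = s ^+ p + t ^+ p.
Proof.
case: p => // m pr char.
rewrite exprDn big_ord_recl big_ord_recr big1 /= => [|i _].
  rewrite add0r /bump /= add1n subn0 subnn !expr0 bin0 binn mulr1 mul1r.
  by rewrite !mulr1n.
have dvd : (m.+1 %| 'C(m.+1, bump 0 i))%N.
  by apply: prime_dvd_bin; rewrite // /bump /= add1n ltnS.
by rewrite -(divnK dvd) mulrnA -mulr_natr char mulr0.
Qed.

Section Frobenius.
Variables (p : nat) (p_prime : prime p).

Lemma Fp_scheme_char (X : ringed_space) (aX : morphism X (Spec 'F_p))
  (U : opens X) : p%:R = 0 :> sec U.
Proof.
pose T : opens (Spec 'F_p) := Opens openT.
have natE n q (Tq : T q) :
    sec_val (n%:R : spec_sec T) Tq = frac n%:R (@notin1 _ q).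
  elim: n => [|n IHn]; first exact: frac0.
  rewrite -[n.+1]addn1 !natrD.
  transitivity (sec_val (n%:R : spec_sec T) Tq + 1) => //.
  by rewrite IHn frac1 fracD; apply: frac_eq_mul; ring.
have T0 : p%:R = 0 :> sec T.
  apply: spec_secP => q Tq; rewrite natE.
  rewrite (_ : p%:R = 0 :> 'F_p) ?pchar_Fp_0 //.
have hU : (U : set X) `<=` preim_mor aX T by [].
have := congr1 (res hU \o comorph aX T) T0.
by rewrite /= !rmorph_nat !rmorph0.
Qed.

Variables (X : ringed_space) (charX : forall U : opens X, p%:R = 0 :> sec U).

Definition frob_comorph (V : opens X) (s : sec V) :
  sec (preim_opens (@idfun_cont X) V) := res (@idfun_sub X V) (s ^+ p).

Fact frob_zmod (V : opens X) : zmod_morphism (@frob_comorph V).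
Proof.
move=> s t; rewrite /frob_comorph -rmorphB; congr (res _ _).
by apply/eqP; rewrite eq_sym subr_eq -exprD_char ?subrK.
Qed.

Fact frob_monoid (V : opens X) : monoid_morphism (@frob_comorph V).
Proof.
split=> [|s t]; rewrite /frob_comorph; first by rewrite expr1n rmorph1.
by rewrite exprMn rmorphM.
Qed.

HB.instance Definition _ (V : opens X) := GRing.isZmodMorphism.Build (sec V)
  (sec (preim_opens (@idfun_cont X) V)) (@frob_comorph V) (@frob_zmod V).
HB.instance Definition _ (V : opens X) := GRing.isMonoidMorphism.Build (sec V)
  (sec (preim_opens (@idfun_cont X) V)) (@frob_comorph V) (@frob_monoid V).

Fact frob_comorph_res (V W : opens X) (h : (W : set X) `<=` V)
    (h' : (preim_opens (@idfun_cont X) W : set X) `<=`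
          preim_opens (@idfun_cont X) V) (s : sec V) :
  frob_comorph (res h s) = res h' (frob_comorph s).
Proof. by rewrite /frob_comorph -rmorphXn /= id_comorph_res. Qed.

Fact frob_local (x : X) (V : opens X) (s : sec V) : V x ->
  germ_unit x (frob_comorph s) -> germ_unit x s.
Proof.
move=> Vx /(id_local Vx) [W [h [Wx [t ht]]]]; exists W, h; split=> //.
exists (res h s ^+ p.-1 * t).
by rewrite mulrA -exprS prednK ?prime_gt0 // -rmorphXn.
Qed.

Definition absolute_frobenius : morphism X X :=
  @Morphism X X idfun (@idfun_cont X) (fun V => @frob_comorph V)
    frob_comorph_res frob_local.
End Frobenius.

(* An F_p-scheme is a scheme X with a structure morphism aX to Spec F_p. *)
Definition F_finite (p : nat) (p_prime : prime p) (X : ringed_space)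
    (aX : morphism X (Spec 'F_p)) : Prop :=
  finite_morphism
    (absolute_frobenius p_prime (Fp_scheme_char p_prime aX)).

(* Up to isomorphism, a square-zero thickening of affine schemes is Spec of a
   surjective ring morphism whose kernel has square zero. *)
Definition square_zero (B C : comPzRingType) (phi : {rmorphism B -> C}) :=
  (forall c, exists b, phi b = c) /\
  (forall a b, phi a = 0 -> phi b = 0 -> a * b = 0).

Definition is_lift (X Y : ringed_space) (f : morphism X Y)
    (B C : comPzRingType) (phi : {rmorphism B -> C})
    (u : morphism (Spec C) X) (v : morphism (Spec B) Y)
    (h : morphism (Spec B) X) : Prop :=
  eq_mor (comp_mor h (Spec_map phi)) u /\ eq_mor (comp_mor f h) v.

Definition formally_smooth (X Y : ringed_space) (f : morphism X Y) : Prop :=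
  forall (B C : comPzRingType) (phi : {rmorphism B -> C}), square_zero phi ->
  forall (u : morphism (Spec C) X) (v : morphism (Spec B) Y),
    eq_mor (comp_mor f u) (comp_mor v (Spec_map phi)) ->
    exists h, is_lift f phi u v h.

Definition formally_etale (X Y : ringed_space) (f : morphism X Y) : Prop :=
  forall (B C : comPzRingType) (phi : {rmorphism B -> C}), square_zero phi ->
  forall (u : morphism (Spec C) X) (v : morphism (Spec B) Y),
    eq_mor (comp_mor f u) (comp_mor v (Spec_map phi)) ->
    exists2 h, is_lift f phi u v h &
      forall h', is_lift f phi u v h' -> eq_mor h' h.

(* pi : E -> S is the projection of the affine n-space over the affine scheme S:
   for S = Spec R it is Spec R[x_1, ..., x_n] -> Spec R. The polynomial ring is
   only available over a nonzero R, so S has to be nonempty. *)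
Definition is_affine_space (n : nat) (E S : ringed_space) (pi : morphism E S) :
    Prop :=
  exists (R : comNzRingType) (e : morphism (Spec R) S)
    (e' : morphism E (Spec (mpoly n R))),
    [/\ is_iso e, is_iso e' &
        eq_mor pi (comp_mor e (comp_mor (Spec_map (mpolyC n (R := R))) e'))].

(* Main.v *)
Require Import Defs.
From HB Require Import structures.
From mathcomp Require Import all_boot all_order all_algebra.
From mathcomp Require Import all_classical topology.
From mathcomp Require Import ring.
(* The notations of mpoly clash with those of mathcomp.classical. *)
From mathcomp Require Import -(notations) mpoly.
(* [frac] would otherwise denote the field of fractions. *)
Import Defs.

(* A chart of X is an open immersion j : Spec A -> X. F-finiteness makes A
   generated over its p-th powers by finitely many b_i, so every derivation D
   satisfies D y = \sum_i c_i^p D b_i. The pairs (a, c) in the square-zero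
   extension of A by A^m such that D a = \sum_i c_i D b_i for all
   R-derivations D form a square-zero extension of A; a section of it, given by formal
   smoothness, splits A^m -> Omega_{A/R}, and so Omega_{A/R} is the image of an
   idempotent matrix M. Expanding det (M + (1 - M)) along the rows produces,
   near a given prime, a matrix of rows of M and of 1 - M whose determinant g is
   invertible; the b_i selecting rows of M are then coordinates over A_g. Since
   two lifts over R of a map to a square-zero quotient differ by a derivation,
   there is exactly one lift with prescribed values on these coordinates, i.e.
   R[x_1, ..., x_n] -> A_g is formally etale. *)

Set Implicit Arguments.
Unset Strict Implicit.
Unset Printing Implicit Defensive.

Import GRing.Theory.

Local Open Scope classical_set_scope.
Local Open Scope ring_scope.

Local Notation "f =m g" := (eq_mor f g) (at level 70).
Local Notation "f \c g" := (comp_mor f g) (at level 45, left associativity).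

(** * Open immersions *)

(** [A] need not be of finite type over [R], so there is no presentation to which a Jacobian
    criterion could apply. F-finiteness takes its place: every derivation kills p-th powers, so
    finitely many d b_i span all differentials. The module of differentials itself is never built;
    statements about it are quantified over all derivations into all A-algebras [B]. This is enough
    because the derivations that matter are endomaps of [A] or differences of two lifts, with values
    in a square-zero ideal of [B]. Choosing rows by a minor outside the given prime replaces the
    local freeness of projective modules, and that minor g is also the element at which the chart is
    localized. On the geometric side, morphisms between spectra are reduced to ring maps, and charts
    are handled through the universal property of open immersions, so that a chart and the open
    subspace it covers can be exchanged. *)

Lemma res_irr (X : ringed_space) (U V : opens X)
    (h h' : (V : set X) `<=` U) (s : sec U) : res h s = res h' s.
Proof. by rewrite (Prop_irrelevance h h'). Qed.

Lemma res_res (X : ringed_space) (U V W : opens X) (hV : (V : set X) `<=` U)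
    (hW : (W : set X) `<=` V) (s : sec U) :
  res hW (res hV s) = res (subset_trans hW hV) s.
Proof. exact: res_comp. Qed.

Lemma eq_morP (X Y : ringed_space) (f g : morphism X Y) : f =1 g ->
  (forall (V : opens Y) (h : (preim_mor f V : set X) `<=` preim_mor g V)
     (s : sec V), comorph f V s = res h (comorph g V s)) -> f =m g.
Proof.
move=> fg e; split=> // V W hf hg s.
have h : (preim_mor f V : set X) `<=` preim_mor g V by move=> x /=; rewrite fg.
by rewrite (e V h) (res_comp _ _ hg).
Qed.

Lemma eq_mor_comorph (X Y : ringed_space) (f g : morphism X Y) (V : opens Y)
    (h : (preim_mor f V : set X) `<=` preim_mor g V) (s : sec V) :
  f =m g -> comorph f V s = res h (comorph g V s).
Proof. by case=> _ e; rewrite -(e V _ (@subset_refl _ _) h) res_id. Qed.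

Lemma eq_mor_refl (X Y : ringed_space) (f : morphism X Y) : f =m f.
Proof. by apply: eq_morP => // V h s; rewrite res_id. Qed.

Lemma eq_mor_sym (X Y : ringed_space) (f g : morphism X Y) : f =m g -> g =m f.
Proof. by case=> b c; split=> [x|V W hf hg s]; rewrite ?b // (c V W hg hf). Qed.

Lemma eq_mor_trans (X Y : ringed_space) (f g h : morphism X Y) :
  f =m g -> g =m h -> f =m h.
Proof.
move=> fg gh; apply: eq_morP => [x|V k s]; first by rewrite fg.1 gh.1.
have kf : (preim_mor f V : set X) `<=` preim_mor g V.
  by move=> x /=; rewrite fg.1.
have kg : (preim_mor g V : set X) `<=` preim_mor h V.
  by move=> x /=; rewrite gh.1.
by rewrite (eq_mor_comorph kf _ fg) (eq_mor_comorph kg _ gh) (res_comp _ _ k).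
Qed.

Lemma comp_mor_comorph (X Y Z : ringed_space) (g : morphism Y Z)
    (f : morphism X Y) (V : opens Z) (s : sec V) :
  comorph (g \c f) V s =
  res (@comp_sub _ _ _ g f V) (comorph f (preim_mor g V) (comorph g V s)).
Proof. by []. Qed.

Lemma comp_mor_eq (X Y Z : ringed_space) (g g' : morphism Y Z)
    (f f' : morphism X Y) : g =m g' -> f =m f' -> g \c f =m g' \c f'.
Proof.
move=> gg ff; apply: eq_morP => [x|V k s]; first by rewrite /= ff.1 gg.1.
have kg : (preim_mor g V : set Y) `<=` preim_mor g' V.
  by move=> y /=; rewrite gg.1.
have kf : (preim_mor f (preim_mor g V) : set X) `<=` preim_mor f' (preim_mor g V).
  by move=> y /=; rewrite ff.1.
have kf' : (preim_mor f' (preim_mor g V) : set X) `<=`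
    preim_mor f' (preim_mor g' V) by move=> y /=; rewrite gg.1.
rewrite !comp_mor_comorph (eq_mor_comorph kg _ gg) (eq_mor_comorph kf _ ff).
rewrite (comorph_res _ kf').
by rewrite !res_res; apply: res_irr.
Qed.

Lemma comp_morA (X Y Z T : ringed_space) (h : morphism Z T) (g : morphism Y Z)
    (f : morphism X Y) : h \c g \c f =m h \c (g \c f).
Proof.
apply: eq_morP => // V k s; rewrite !comp_mor_comorph.
have k' : (preim_mor f (preim_mor (h \c g) V) : set X) `<=`
  preim_mor f (preim_mor g (preim_mor h V)) by [].
by rewrite (comorph_res _ k') !res_res; apply: res_irr.
Qed.

Lemma comp_id_mor (X Y : ringed_space) (f : morphism X Y) : id_mor Y \c f =m f.
Proof.
apply: eq_morP => // V k s; rewrite comp_mor_comorph /=.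
have k' : (preim_mor f (preim_opens (@idfun_cont Y) V) : set X) `<=`
  preim_mor f V by [].
by rewrite (comorph_res _ k') !res_res; apply: res_irr.
Qed.

Lemma comp_mor_id (X Y : ringed_space) (f : morphism X Y) : f \c id_mor X =m f.
Proof.
apply: eq_morP => // V k s; rewrite comp_mor_comorph /=.
by rewrite !res_res; apply: res_irr.
Qed.

Lemma comp_eq_morl (X Y Z : ringed_space) (g g' : morphism Y Z)
    (f : morphism X Y) : g =m g' -> g \c f =m g' \c f.
Proof. by move=> e; apply: comp_mor_eq => //; apply: eq_mor_refl. Qed.

Lemma comp_eq_morr (X Y Z : ringed_space) (g : morphism Y Z)
    (f f' : morphism X Y) : f =m f' -> g \c f =m g \c f'.
Proof. by move=> e; apply: comp_mor_eq => //; apply: eq_mor_refl. Qed.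

Lemma bij_rmorphism (A B : comPzRingType) (f : {rmorphism A -> B}) :
  bijective f -> exists g : {rmorphism B -> A}, cancel f g /\ cancel g f.
Proof.
case=> g fK gK.
pose gM := GRing.isMonoidMorphism.Build B A g (can2_monoid_morphism fK gK).
pose gA := GRing.isZmodMorphism.Build B A g (can2_zmod_morphism fK gK).
pose g' : {rmorphism B -> A} := HB.pack g gA gM.
by exists g'.
Qed.

(* An open immersion is characterized by its functor of points. *)
Definition open_imm (T X : ringed_space) (j : morphism T X) : Prop :=
  [/\ injective j, forall W : opens T, open (j @` W) &
  forall (S : ringed_space) (h : morphism S X),
    (forall s, range j (h s)) ->
    exists k : morphism S T, j \c k =m h /\
      forall k', j \c k' =m h -> k' =m k].

Lemma open_imm_mono (T X S : ringed_space) (j : morphism T X)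
    (k k' : morphism S T) : open_imm j -> j \c k =m j \c k' -> k =m k'.
Proof.
move=> [_ _ jP] e; have [|l [_ lP]] := jP S (j \c k').
  by move=> s; exists (k' s).
by apply: (eq_mor_trans (lP k e)); apply/eq_mor_sym/lP/eq_mor_refl.
Qed.

Lemma open_imm_lift (T X S : ringed_space) (j : morphism T X)
    (h : morphism S X) : open_imm j -> (forall s, range j (h s)) ->
  exists k : morphism S T, j \c k =m h.
Proof. by move=> [_ _ jP] /jP[k [kP _]]; exists k. Qed.

(** * A topological and sheaf-theoretic criterion for open immersions *)

Section Criterion.
Variables (T X : ringed_space) (j : morphism T X).
Hypothesis j_inj : injective j.
Hypothesis j_open : forall W : opens T, open (j @` W).
Hypothesis j_bij : forall V : opens X, (V : set X) `<=` range j ->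
  bijective (comorph j V).

Section Lift.
Variables (S : ringed_space) (h : morphism S X).
Hypothesis hj : forall s, range j (h s).

Let base_lift (s : S) : T := sval (cid2 (hj s)).

Let base_liftK s : j (base_lift s) = h s.
Proof. by rewrite /base_lift; case: cid2. Qed.

Let img (W : opens T) : opens X := Opens (@j_open W).

Let img_sub (W : opens T) : (img W : set X) `<=` range j.
Proof. by move=> _ [t _ <-]; exists t. Qed.

Let preim_img (W : opens T) : (preim_mor j (img W) : set T) `<=` W.
Proof. by move=> t [t' Wt' /j_inj <-]. Qed.

Let preim_lift (W : opens T) s : W (base_lift s) <-> preim_mor h (img W) s.
Proof.
rewrite /= -base_liftK; split; first by exists (base_lift s).
by case=> t Wt /j_inj <-.
Qed.

Let lift_cont : continuous base_lift.
Proof.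
apply/continuousP => W oW.
have -> : base_lift @^-1` W = preim_mor h (img (Opens oW)).
  by apply/seteqP; split=> s /(preim_lift (Opens oW)).
exact: oset_open.
Qed.

Let lift_sub (W : opens T) :
  (preim_opens lift_cont W : set S) `<=` preim_mor h (img W).
Proof. by move=> s /preim_lift. Qed.

Let jinv (V : opens X) (hV : (V : set X) `<=` range j) :
    {rmorphism sec (preim_mor j V) -> sec V} :=
  sval (cid (bij_rmorphism (j_bij hV))).

Let jinvK (V : opens X) hV : cancel (@jinv V hV) (comorph j V).
Proof. by rewrite /jinv; case: cid => g []. Qed.

Let jinvK' (V : opens X) hV : cancel (comorph j V) (@jinv V hV).
Proof. by rewrite /jinv; case: cid => g []. Qed.

(** A section over [W] goes to the open j^-1(j W), which has the same points, then to j W by the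
    inverse of [comorph j], and is pulled back along [h]. *)
Let lift_comorph (W : opens T) :
    {rmorphism sec W -> sec (preim_opens lift_cont W)} :=
  res (@lift_sub W) \o (comorph h (img W) \o
    (jinv (@img_sub W) \o res (@preim_img W))).

Let lift_comorph_res (V W : opens T) (k : (W : set T) `<=` V)
    (k' : (preim_opens lift_cont W : set S) `<=` preim_opens lift_cont V)
    (s : sec V) : lift_comorph W (res k s) = res k' (lift_comorph V s).
Proof.
have ki : (img W : set X) `<=` img V by move=> _ [t /k Vt <-]; exists t.
have kh : (preim_mor h (img W) : set S) `<=` preim_mor h (img V).
  by move=> x /ki.
have kj : (preim_mor j (img W) : set T) `<=` preim_mor j (img V).
  by move=> x /ki.
have -> : lift_comorph W (res k s) = res (@lift_sub W) (comorph h (img W)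
    (res ki (jinv (@img_sub V) (res (@preim_img V) s)))).
  rewrite /lift_comorph /=; congr (res _ (comorph h _ _)).
  (* After the injective map [comorph j], both sides become restrictions of [s]. *)
  apply: (can_inj (jinvK' (@img_sub W))).
  by rewrite jinvK (comorph_res _ kj) jinvK !res_res; apply: res_irr.
by rewrite (comorph_res _ kh) /= !res_res; apply: res_irr.
Qed.

Let lift_comorph_img (V : opens X)
    (k : (preim_opens lift_cont (preim_mor j V) : set S) `<=` preim_mor h V)
    (s : sec V) :
  lift_comorph (preim_mor j V) (comorph j V s) = res k (comorph h V s).
Proof.
have ki : (img (preim_mor j V) : set X) `<=` V by move=> _ [t ? <-].
have kh : (preim_mor h (img (preim_mor j V)) : set S) `<=` preim_mor h V.
  by move=> x /ki.
have kj : (preim_mor j (img (preim_mor j V)) : set T) `<=` preim_mor j V.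
  by move=> x /ki.
rewrite /lift_comorph /=.
have -> : jinv (@img_sub (preim_mor j V))
    (res (@preim_img (preim_mor j V)) (comorph j V s)) = res ki s.
  apply: (can_inj (jinvK' (@img_sub (preim_mor j V)))).
  by rewrite jinvK (comorph_res _ kj); apply: res_irr.
by rewrite (comorph_res _ kh) !res_res; apply: res_irr.
Qed.

Let germ_unit_res (Y : ringed_space) (y : Y) (U V : opens Y)
   (k : (V : set Y) `<=` U) (s : sec U) : V y ->
  germ_unit y (res k s) <-> germ_unit y s.
Proof.
move=> Vy; split=> -[W [l [Wy [t e]]]].
  exists W, (subset_trans l k); split=> //.
  by exists t; rewrite -res_res.
have oWV : open ((W : set Y) `&` V) by apply: openI; apply: oset_open.
have lW : (Opens oWV : set Y) `<=` W by move=> ? [].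
have lV : (Opens oWV : set Y) `<=` V by move=> ? [].
exists (Opens oWV), lV; split=> //; exists (res lW t).
rewrite -(rmorph1 (res lW)) -e rmorphM /= !res_res; congr (_ * _).
exact: res_irr.
Qed.

(** [s] is the pullback along [j] of a section over j V. Locality of [h] makes that section
    invertible near h x, and pulling back along [j] makes [s] invertible. *)
Let lift_local (x : S) (V : opens T) (s : sec V) : V (base_lift x) ->
  germ_unit x (lift_comorph V s) -> germ_unit (base_lift x) s.
Proof.
move=> Vx; rewrite /lift_comorph /= germ_unit_res // => u.
have hx : img V (h x) by apply/preim_lift.
have := germ_local hx u => -[W [k [Wx [t e]]]].
have jx : preim_mor j (img V) (base_lift x) by exists (base_lift x).
suff : germ_unit (base_lift x) (res (@preim_img V) s).
  by rewrite germ_unit_res.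
have kj : (preim_mor j W : set T) `<=` preim_mor j (img V) by move=> y /k.
exists (preim_mor j W), kj; split; first by rewrite /= base_liftK.
exists (comorph j W t).
rewrite -[res (@preim_img V) s](jinvK (@img_sub V)) -(comorph_res k kj).
by rewrite -rmorphM e rmorph1.
Qed.

Let lift_mor : morphism S T := Morphism lift_comorph_res lift_local.

Lemma open_imm_lift_ex : exists k : morphism S T, j \c k =m h /\
      forall k', j \c k' =m h -> k' =m k.
Proof.
exists lift_mor; split.
  apply: eq_morP => // V k s; rewrite comp_mor_comorph.
  by rewrite [comorph lift_mor _ _](lift_comorph_img k) res_res; apply: res_irr.
move=> k' e; apply: eq_morP => [s|V l s].
  by apply: j_inj; rewrite -[j (k' s)]/((j \c k') s) e.1 -[LHS]base_liftK.
have lV : (V : set T) `<=` preim_mor j (img V) by move=> t Vt; exists t.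
(* Every section over [V] is a restriction of one pulled back from [X], so the composite of [j] and
   [k'] determines the comorphism of [k']. *)
set s' := jinv (@img_sub V) (res (@preim_img V) s).
have es : s = res lV (comorph j (img V) s').
  by rewrite jinvK res_res res_id.
have k1 : (preim_mor k' V : set S) `<=` preim_mor k' (preim_mor j (img V)).
  by move=> x; apply: lV.
have k2 : (preim_mor (j \c k') (img V) : set S) `<=` preim_mor h (img V).
  by move=> x /=; rewrite -e.1.
have k3 : (preim_mor k' V : set S) `<=` preim_mor (j \c k') (img V) := k1.
have e1 := eq_mor_comorph k2 s' e.
rewrite comp_mor_comorph in e1.
transitivity (res k3 (res (@comp_sub _ _ _ j k' (img V))
    (comorph k' _ (comorph j (img V) s')))).
  by rewrite {1}es (comorph_res _ k1) res_res; apply: res_irr.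
by rewrite e1 /= /lift_comorph /= !res_res; apply: res_irr.
Qed.

End Lift.

Lemma open_imm_crit : open_imm j.
Proof. by split=> // S h; apply: open_imm_lift_ex. Qed.
End Criterion.

Lemma open_imm_range (T X : ringed_space) (j : morphism T X) :
  open_imm j -> open (range j).
Proof.
case=> _ /(_ (Opens openT)) /= h _.
by congr (open _): h; apply/seteqP.
Qed.

Lemma comp_open_imm (T X Y : ringed_space) (i : morphism X Y)
    (j : morphism T X) : open_imm i -> open_imm j -> open_imm (i \c j).
Proof.
move=> iI jI; have [ii io _] := iI; have [ji jo _] := jI; split.
- by move=> s t /ii /ji.
- by move=> W; have := io (Opens (jo W)); rewrite /= -image_comp.
move=> S h hij.
have [|k ek] := open_imm_lift iI (h := h).
  by move=> s; have [t _ e] := hij s; exists (j t).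
have [|l el] := open_imm_lift jI (h := k).
  move=> s; have [t _ e] := hij s; exists t => //.
  by apply: ii; rewrite -[RHS]/((i \c k) s) ek.1 -e.
exists l; split.
  apply: (eq_mor_trans (comp_morA _ _ _)).
  exact: eq_mor_trans (comp_eq_morr _ el) ek.
move=> l' el'; apply: (open_imm_mono jI); apply: (open_imm_mono iI).
apply: (eq_mor_trans (eq_mor_sym (comp_morA _ _ _))).
apply: (eq_mor_trans el'); apply: eq_mor_sym.
exact: eq_mor_trans (comp_eq_morr _ el) ek.
Qed.

Lemma iso_open_imm (T X : ringed_space) (j : morphism T X) (j' : morphism X T) :
  j' \c j =m id_mor T -> j \c j' =m id_mor X -> open_imm j.
Proof.
move=> j'j jj'; have jK : cancel j j' := j'j.1; have jK' : cancel j' j := jj'.1.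
split; first exact: can_inj jK.
  move=> W; have -> : j @` W = preim_mor j' W; last exact: oset_open.
  apply/seteqP; split=> [_ [t Wt <-]|x Wx] /=; first by rewrite jK.
  by exists (j' x).
move=> S h _; exists (j' \c h); split.
  apply: (eq_mor_trans (eq_mor_sym (comp_morA _ _ _))).
  apply: (eq_mor_trans (comp_eq_morl _ jj')); exact: comp_id_mor.
move=> k e; apply: (eq_mor_trans _ (comp_eq_morr _ e)).
apply: (eq_mor_trans _ (comp_morA _ _ _)); apply: eq_mor_sym.
exact: eq_mor_trans (comp_eq_morl _ j'j) (comp_id_mor _).
Qed.

Section Inclusion.
Variables (X : ringed_space) (U : opens X).

Let incl_cont : continuous (set_val : open_subspace U -> X).
Proof. by apply/continuousP => A oA; exists A. Qed.

Let incl_sub (V : opens X) :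
  (opens_val (preim_opens incl_cont V) : set X) `<=` V.
Proof. by move=> _ [x Vx <-]. Qed.

Let incl_res (V W : opens X) (h : (W : set X) `<=` V)
  (h' : (preim_opens incl_cont W : set (open_subspace U)) `<=`
        preim_opens incl_cont V) (s : sec V) :
  res (@incl_sub W) (res h s) = res (opens_valS h') (res (@incl_sub V) s).
Proof. by rewrite !res_res; apply: res_irr. Qed.

Let incl_local (x : open_subspace U) (V : opens X) (s : sec V) :
  V (set_val x) ->
  @germ_unit (open_subspace U) x (preim_opens incl_cont V)
    (res (@incl_sub V) s) ->
  germ_unit (set_val x) s.
Proof.
move=> Vx [W [k [Wx [t e]]]].
exists (opens_val W), (subset_trans (opens_valS k) (@incl_sub V)); split.
  by exists x.
by exists t; rewrite -res_res.
Qed.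

Definition open_incl : morphism (open_subspace U) X :=
  @Morphism (open_subspace U) X _ incl_cont (fun V => res (@incl_sub V))
    incl_res incl_local.

Lemma open_incl_range : range open_incl = U.
Proof.
apply/seteqP; split=> [_ [x _ <-]|x Ux]; first exact: set_mem (valP x).
by exists (SigSub (mem_set Ux)).
Qed.

Lemma open_incl_imm : open_imm open_incl.
Proof.
apply: open_imm_crit; first exact: val_inj.
  by move=> W; apply: (@opens_val_open _ U W).
move=> V; rewrite open_incl_range => VU.
have sub : (V : set X) `<=` opens_val (preim_opens incl_cont V).
  by move=> x Vx; exists (SigSub (mem_set (VU _ Vx))).
exists (res sub) => s /=.
  by rewrite res_res; apply: res_id.
by rewrite res_res; apply: res_id.
Qed.
End Inclusion.

Lemma open_incl_restrict (X Y : ringed_space) (f : morphism X Y) (U : opens X)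
    (V : opens Y) (fUV : forall x, U x -> V (f x)) :
  open_incl V \c restrict_mor fUV =m f \c open_incl U.
Proof.
apply: eq_morP => // W k s.
have k' : (preim_mor f (opens_val (preim_mor (open_incl V) W)) : set X) `<=`
  preim_mor f W by move=> x [y Wy yx]; rewrite /= -yx.
rewrite !comp_mor_comorph /= (comorph_res _ k').
by rewrite !res_res; apply: res_irr.
Qed.

(** Each of [j] and the inclusion factors through the other; the two factors are inverse because
    both immersions are monomorphisms. *)
Lemma open_imm_iso (T X : ringed_space) (j : morphism T X) (U : opens X) :
  open_imm j -> range j = U ->
  exists k : morphism (open_subspace U) T, is_iso k /\ j \c k =m open_incl U.
Proof.
move=> jI jU.
have [|k ek] := open_imm_lift jI (h := open_incl U).
  by move=> s; rewrite jU -open_incl_range; exists s.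
have [|l el] := open_imm_lift (open_incl_imm U) (h := j).
  by move=> s; rewrite open_incl_range -jU; exists s.
exists k; split=> //; exists l; split.
  apply: (open_imm_mono (open_incl_imm U)).
  apply: (eq_mor_trans (eq_mor_sym (comp_morA _ _ _))).
  apply: (eq_mor_trans (comp_eq_morl _ el)); apply: (eq_mor_trans ek).
  by apply: eq_mor_sym; apply: comp_mor_id.
apply: (open_imm_mono jI); apply: (eq_mor_trans (eq_mor_sym (comp_morA _ _ _))).
apply: (eq_mor_trans (comp_eq_morl _ ek)); apply: (eq_mor_trans el).
by apply: eq_mor_sym; apply: comp_mor_id.
Qed.

(** * Sections over basic open sets *)

Section PrimeAvoidance.
Variable A : comPzRingType.
Implicit Types (I J : A -> Prop) (a b f g h u : A) (p : spec A).

Definition ideal I : Prop :=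
  [/\ I 0, forall a b, I a -> I b -> I (a + b) & forall a b, I b -> I (a * b)].

(** An ideal maximal among those that contain [I] and miss all powers of [g] is prime; Zorn's lemma
    provides one. *)
Lemma prime_not_powers I g : ideal I -> (forall k, ~ I (g ^+ k)) ->
  exists2 p : spec A, (forall a, I a -> p a) & ~ p g.
Proof.
move=> Iid Ig.
(* The empty set is allowed so that the union of the empty chain qualifies. *)
pose P (J : set A) := J = set0 \/
  [/\ ideal J, I `<=` J & forall k, ~ J (g ^+ k)].
have PJ J a : P J -> J a -> [/\ ideal J, I `<=` J & forall k, ~ J (g ^+ k)].
  by case=> // ->.
have [F FP tot|J [[->|[Jid IJ Jg]] Jmax]] := @Zorn_bigcup A P.
- have [/eqP ->|/set0P[a [J FJ Ja]]] := boolP (\bigcup_(X in F) X == set0).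
    by left.
  right; have [[J0 _ _] IJ _] := PJ _ _ (FP _ FJ) Ja; split.
  + split; first by exists J.
      move=> x y [K FK Kx] [L FL Ly].
      have [KL|LK] := tot _ _ FK FL.
        exists L => //; have [[_ h _] _ _] := PJ _ _ (FP _ FL) Ly.
        by apply/h => //; apply: KL.
      exists K => //; have [[_ h _] _ _] := PJ _ _ (FP _ FK) Kx.
      by apply/h => //; apply: LK.
    move=> x y [K FK Ky]; exists K => //.
    by have [[_ _ h] _ _] := PJ _ _ (FP _ FK) Ky; apply: h.
  + by move=> x Ix; exists J => //; apply: IJ.
  + move=> k [K FK Kg]; have [_ _ h] := PJ _ _ (FP _ FK) Kg.
    exact: (h k).
(* The empty set is not maximal, since [I] is a larger candidate. *)
- have PI : P I by right; split.
  suff pI : set0 `<` I by have := Jmax I pI PI.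
  split; first exact: sub0set.
  by move=> /(_ 0); apply; case: Iid.
have [J0 JD JM] := Jid.
(* By maximality, adjoining any [c] outside [J] brings in a power of [g]. *)
have Jext c : ~ J c -> exists k b d, J b /\ g ^+ k = b + d * c.
  move=> Jc; pose K : set A := [set x | exists b d, J b /\ x = b + d * c].
  have Kid : ideal K; first split.
  - by exists 0, 0; split=> //; ring.
  - move=> _ _ [b [d [Jb ->]]] [b' [d' [Jb' ->]]]; exists (b + b'), (d + d').
    by split; [exact: JD|ring].
  - move=> x _ [b [d [Jb ->]]]; exists (x * b), (x * d).
    by split; [exact: JM|ring].
  have JK : J `<=` K by move=> b Jb; exists b, 0; split=> //; ring.
  suff [k [b [d h]]] : exists k, K (g ^+ k) by exists k, b, d.
  apply: contrapT => Kg; have : J `<` K.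
    by split=> // KJ; apply/Jc/KJ; exists 0, 1; split=> //; ring.
  move=> /(Jmax K); apply; right; split=> //; first exact: subset_trans JK.
  by move=> k Kgk; apply: Kg; exists k.
have Jp : prime_ideal J.
  split=> //; first exact: (Jg 0%N).
  move=> a b Jab; apply: contrapT => /not_orP[/Jext[k [c [d [Jc ea]]]]].
  move=> /Jext[l [c' [d' [Jc' eb]]]]; apply: (Jg (k + l)%N).
  rewrite exprD ea eb.
  have -> : (c + d * a) * (c' + d' * b) =
    (c' + d' * b) * c + (d * a * c' + (d * d') * (a * b)) by ring.
  by do 2?apply: (JD); apply: (JM).
by exists (Prime Jp) => //=; apply: (Jg 1%N).
Qed.

(** Otherwise some prime contains the annihilator of [x] and avoids [f]; but the [u] given at that
    prime annihilates [x]. *)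
Lemma annihilated_power (x f : A) :
  (forall p, ~ p f -> exists2 u, ~ p u & u * x = 0) ->
  exists k, f ^+ k * x = 0.
Proof.
move=> h; apply: contrapT => hk.
have [|k fk|p Ip /h[u pu ux]] := @prime_not_powers (fun a => a * x = 0) f.
- split=> [|a b ea eb|a b eb]; first by rewrite mul0r.
    by rewrite mulrDl ea eb addr0.
  by rewrite -mulrA eb mulr0.
- by apply: hk; exists k.
exact/pu/Ip.
Qed.

(** This is quasi-compactness of D(g): if the ideal spanned by [S] missed all powers of [g], a prime
    containing it and avoiding [g] would escape the cover. The pairs are coefficient and element of
    [S]. *)
Lemma power_in_span (S : set A) g :
  (forall p, ~ p g -> exists2 h, S h & ~ p h) ->
  exists k (l : seq (A * A)), (forall x, x \in l -> S x.2) /\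
    g ^+ k = \sum_(x <- l) x.1 * x.2.
Proof.
move=> hS; apply: contrapT => hk.
pose I a := exists l : seq (A * A), (forall x, x \in l -> S x.2) /\
    a = \sum_(x <- l) x.1 * x.2.
have [|k [l gk]|p Ip /hS[h Sh ph]] := @prime_not_powers I g.
- split.
  + by exists [::]; rewrite big_nil.
  + move=> _ _ [l [lS ->]] [l' [lS' ->]]; exists (l ++ l'); rewrite big_cat.
    by split=> // x; rewrite mem_cat => /orP[/lS|/lS'].
  + move=> a _ [l [lS ->]]; exists [seq (a * x.1, x.2) | x <- l].
    split; first by move=> _ /mapP[y /lS yS ->].
    by rewrite big_map mulr_sumr; apply: eq_bigr => x _; rewrite mulrA.
- by apply: hk; exists k, l.
apply/ph/Ip; exists [:: (1, h)]; rewrite big_seq1 mul1r; split=> // x.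
by rewrite inE => /eqP ->.
Qed.

Lemma notinX p g k : ~ p g -> ~ p (g ^+ k).
Proof.
by move=> pg; elim: k => [|k IHk]; [exact: notin1|rewrite exprS; exact: notinM].
Qed.

Lemma notinMl p a b : ~ p (a * b) -> ~ p b.
Proof. by move=> h pb; apply: h; have [_ _ pM _ _] := pset_prime p; apply: pM. Qed.

Lemma notinMr p a b : ~ p (a * b) -> ~ p a.
Proof. by rewrite mulrC => /notinMl. Qed.

Lemma notin_sum p (T : Type) (l : seq T) (F : T -> A) :
  ~ p (\sum_(x <- l) F x) ->
  exists2 i, (i < size l)%N & forall x0, ~ p (F (nth x0 l i)).
Proof.
have [p0 pD _ _ _] := pset_prime p.
elim: l => [|x l IHl]; first by rewrite big_nil.
rewrite big_cons => h; have [pFx|pFx] := pselect (p (F x)).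
  have h' : ~ p (\sum_(x <- l) F x) by move=> h'; apply/h/pD.
  by have [i il hi] := IHl h'; exists i.+1.
by exists 0%N.
Qed.

Fact basic_open_open g : open [set p : spec A | ~ p g].
Proof.
exists [set g]; apply/seteqP; split=> p /=; first by exists g.
by case=> _ ->.
Qed.

Definition basic_open g : opens (spec A) := Opens (basic_open_open g).

Lemma basic_open_sub (U : opens (spec A)) p : U p ->
  exists2 g, ~ p g & (basic_open g : set (spec A)) `<=` U.
Proof.
have [E EU] := oset_open U.
have UE (q : spec A) : U q = (exists2 g, E g & ~ q g) := congr1 (@^~ q) EU.
by rewrite UE => -[g Eg pg]; exists g => // q qg; rewrite UE; exists g.
Qed.

End PrimeAvoidance.

Section Sections.
Variable A : comPzRingType.
Implicit Types (U : opens (spec A)) (a : A).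

Lemma frac_eq0 (p : spec A) a b (pb : ~ p b) :
  frac a pb = 0 <-> exists2 u, ~ p u & u * a = 0.
Proof.
by rewrite frac0 frac_eq; split=> -[u pu]; rewrite mulr1 mul0r subr0; exists u.
Qed.

Definition loc_cst (p : spec A) a : loc p := frac a (@notin1 _ p).

Fact spec_cst_regular U a : (fun p _ => loc_cst p a) \in @regular_germs A U.
Proof.
by apply/asboolP => p Up; exists a, 1, U; split=> // q _ _; exists (@notin1 _ q).
Qed.

Definition spec_cst U a : spec_sec U := SpecSec (spec_cst_regular U a).

Fact spec_cst_zmod U : zmod_morphism (spec_cst U).
Proof.
move=> a b; apply: spec_secP => p Up.
rewrite /= -[RHS]/(loc_cst p a - loc_cst p b) /loc_cst fracN fracD.
by apply: frac_eq_mul; ring.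
Qed.

Fact spec_cst_monoid U : monoid_morphism (spec_cst U).
Proof.
split=> [|a b]; apply: spec_secP => p Up; first by [].
rewrite /= -[RHS]/(loc_cst p a * loc_cst p b) /loc_cst fracM.
by apply: frac_eq_mul; ring.
Qed.

HB.instance Definition _ U :=
  GRing.isZmodMorphism.Build A (spec_sec U) (spec_cst U) (spec_cst_zmod U).
HB.instance Definition _ U :=
  GRing.isMonoidMorphism.Build A (spec_sec U) (spec_cst U) (spec_cst_monoid U).

Section BasicOpen.
Variables (U : opens (spec A)) (g : A).
Hypothesis Ug : forall p, U p <-> ~ p g.

Lemma spec_cst_eq0 a : spec_cst U a = 0 -> exists k, g ^+ k * a = 0.
Proof.
move=> e; apply: annihilated_power => p /Ug Up.
apply/(frac_eq0 _ (@notin1 _ p)).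
exact: (congr1 (fun s : spec_sec U => sec_val s Up) e).
Qed.

(** The section is a fraction on each of finitely many basic open sets; the relation that writes a
    power of [g] through the denominators also combines the numerators into a global one. *)
Lemma spec_sec_basic_open (s : spec_sec U) : exists k a,
  forall p (Up : U p) (gk : ~ p (g ^+ k)), sec_val s Up = frac a gk.
Proof.
pose R h a := forall p (Up : U p) (ph : ~ p h), sec_val s Up = frac a ph.
pose S h := (forall p : spec A, ~ p h -> U p) /\ exists a, R h a.
have [|k [l [lS gk]]] := @power_in_span A S g.
  move=> p /Ug Up; have [a [b [W [Wp hW]]]] := spec_sec_frac s Up.
  have [e pe eW] := basic_open_sub Wp.
  have [pb _] := hW _ Wp Up.
  (* On D(e) the section is a / b. The factor [g] keeps the new basic open set inside [U], and [e]
     keeps it where the fraction is valid. *)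
  exists (g * e * b); last by apply: notinM => //; apply: notinM => //; apply/Ug.
  split; first by move=> q /notinMr/notinMr/Ug.
  exists (g * e * a) => q Uq qh.
  have [qb ->] := hW q (eW q (notinMl (notinMr qh))) Uq.
  by apply: frac_eq_mul; ring.
pose a h := if pselect (exists a, R h a) is left ex then sval (cid ex) else 0.
have aP h : S h -> R h (a h).
  by case=> _ ex; rewrite /a; case: pselect => // ex'; case: cid.
(* On D(h h') the two fractions agree, so a power of h h' kills their cross difference; the maximum
   [N] below serves the whole finite cover. *)
have exN h h' : exists N, S h -> S h' -> (h * h') ^+ N * (a h * h' - a h' * h) = 0.
  have [[Sh Sh']|nS] := pselect (S h /\ S h'); last first.
    by exists 0%N => Sh Sh'; case: nS.
  have [|N e] := @annihilated_power A (a h * h' - a h' * h) (h * h');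
    last by exists N.
  move=> p phh'; have ph := notinMr phh'; have ph' := notinMl phh'.
  have Up := Sh.1 _ ph.
  by apply/(frac_eq _ ph _ ph'); rewrite -(aP _ Sh _ Up) -(aP _ Sh' _ Up).
pose Nf h h' := sval (cid (exN h h')).
pose N := (\max_(x <- l) \max_(y <- l) Nf x.2 y.2)%N.
have NP x y : x \in l -> y \in l ->
    (x.2 * y.2) ^+ N * (a x.2 * y.2 - a y.2 * x.2) = 0.
  move=> xl yl.
  have le : (Nf x.2 y.2 <= N)%N.
    apply: (@leq_trans (\max_(z <- l) Nf x.2 z.2)).
      exact: (@leq_bigmax_seq _ l predT (fun z : A * A => Nf x.2 z.2)).
    exact: (@leq_bigmax_seq _ l predT (fun z : A * A => \max_(y <- l) Nf z.2 y.2)%N).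
  have e : (x.2 * y.2) ^+ (Nf x.2 y.2) * (a x.2 * y.2 - a y.2 * x.2) = 0.
    by rewrite /Nf; case: cid => ? /=; apply; apply: lS.
  by rewrite -(subnK le) exprD -mulrA e mulr0.
have lcover (p : spec A) : ~ p g -> exists2 x, x \in l & ~ p x.2.
  move=> pg; have := @notinX A p g k pg; rewrite gk.
  move=> /notin_sum[i il] /(_ (0, 0)) h.
  by exists (nth (0, 0) l i); [exact: mem_nth|exact: notinMl h].
(* Rewriting a / h as a h^N / h^(N+1) absorbs the exponent: the cross differences of the new
   fractions vanish outright. *)
pose S' y b := exists2 x : A * A, x \in l & y = x.2 ^+ N.+1 /\ b = a x.2 * x.2 ^+ N.
have [p pg|k' [l' [lS' gk']]] := @power_in_span A (fun y => exists b, S' y b) g.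
  have [x xl px] := lcover _ pg; exists (x.2 ^+ N.+1); last exact: notinX.
  by exists (a x.2 * x.2 ^+ N), x.
pose b y := if pselect (exists b, S' y b) is left ex then sval (cid ex) else 0.
have bP x : x \in l' -> S' x.2 (b x.2).
  by move=> /lS' ex; rewrite /b; case: pselect => // ex'; case: cid.
exists k', (\sum_(x <- l') x.1 * b x.2) => p Up pgk.
have [x xl px] := lcover p (proj1 (Ug p) Up).
rewrite (aP _ (lS _ xl) _ Up px); apply/frac_eq.
exists (x.2 ^+ N); first exact: notinX.
rewrite gk' mulr_sumr mulr_suml -sumrB mulr_sumr big_seq big1 // => y yl'.
have [z zl [-> ->]] := bP _ yl'.
transitivity (y.1 * ((x.2 * z.2) ^+ N * (a x.2 * z.2 - a z.2 * x.2))).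
  rewrite exprMn exprSr.
  by move: (x.2 ^+ N) (z.2 ^+ N) (a x.2) (a z.2) => *; ring.
by rewrite NP ?mulr0.
Qed.

End BasicOpen.

(** The case g = 1. It is stated for any [U] containing every prime because a preimage of [topO] is
    such an open set without being [topO] itself. *)
Lemma spec_cst_bij U : (forall p, U p) -> bijective (spec_cst U).
Proof.
move=> UT; have U1 p : U p <-> ~ p 1 by split=> // _; apply: notin1.
have ex s : exists a, spec_cst U a = s.
  have [k [a h]] := spec_sec_basic_open U1 s; exists a; apply: spec_secP => p Up.
  have pk : ~ p (1 ^+ k) by rewrite expr1n; apply: notin1.
  by rewrite (h p Up pk); apply: frac_eq_mul; rewrite expr1n.
have inj : injective (spec_cst U).
  move=> a b /eqP; rewrite -subr_eq0 -rmorphB => /eqP /(spec_cst_eq0 U1)[k].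
  by rewrite expr1n mul1r => /eqP; rewrite subr_eq0 => /eqP.
exists (fun s => sval (cid (ex s))) => [a|s]; last by case: cid.
by apply: inj; case: cid.
Qed.

End Sections.

(** * Morphisms of affine schemes *)
Lemma inj_surj_bij (T U : Type) (f : T -> U) :
  injective f -> (forall y, exists x, f x = y) -> bijective f.
Proof.
move=> fI fS; exists (fun y => sval (cid (fS y))) => [x|y]; last by case: cid.
by apply: fI; case: cid.
Qed.

Lemma pull_germ_unit (X Y : ringed_space) (f : morphism X Y) (x : X)
    (V : opens Y) (s : sec V) :
  germ_unit (f x) s -> germ_unit x (comorph f V s).
Proof.
move=> [W [k [Wx [t e]]]].
have k' : (preim_mor f W : set X) `<=` preim_mor f V by move=> y /k.
exists (preim_mor f W), k'; split=> //; exists (comorph f W t).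
by rewrite -(comorph_res k k') -rmorphM e rmorph1.
Qed.

Lemma spec_ext (A : comPzRingType) (p q : spec A) :
  (forall a, p a <-> q a) -> p = q.
Proof.
case: p q => [p pP] [q qP] /= pq.
have e : p = q by apply/funext => a; apply/propext.
by case: _ / e qP {pq} => qP; rewrite (Prop_irrelevance pP qP).
Qed.

Lemma eq_frac (A : comPzRingType) (p : spec A) (y : loc p) a b (pb : ~ p b) :
  y * loc_cst p b = loc_cst p a -> y = frac a pb.
Proof.
move=> e; have : y * loc_cst p b * frac 1 pb = loc_cst p a * frac 1 pb by rewrite e.
rewrite /loc_cst -mulrA !fracM.
have -> : frac (b * 1) (notinM (@notin1 A p) pb) = 1.
  by rewrite frac1; apply: frac_eq_mul; ring.
by rewrite mulr1 => ->; apply: frac_eq_mul; ring.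
Qed.

Definition topO (A : comPzRingType) : opens (spec A) := Opens openT.

Lemma res_cst (A : comPzRingType) (U V : opens (spec A))
    (h : (V : set (spec A)) `<=` U) a :
  @res (Spec A) _ _ h (spec_cst U a) = spec_cst V a.
Proof. exact: spec_secP. Qed.

Lemma germ_unit_cst (A : comPzRingType) (V : opens (spec A)) (p : spec A) a :
  V p -> @germ_unit (Spec A) p V (spec_cst V a) <-> ~ p a.
Proof.
move=> Vp; split=> [[W [k [Wp [t e]]]]|pa].
  have {e} := congr1 (fun s : spec_sec W => sec_val s Wp) e.
  exact: frac_unit.
pose W := Opens (@opensI_open A (basic_open a) V).
have k : (W : set (spec A)) `<=` V by move=> q [].
pose t : germs W := fun q Wq => frac 1 (Wq.1 : ~ q a).
have tr : t \in @regular_germs A W.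
  by apply/asboolP => q Wq; exists 1, a, W; split=> // r Wr Ur; exists Ur.1.
exists W, k; split=> //; exists (SpecSec tr); apply: spec_secP => q Wq.
rewrite -[LHS]/(loc_cst q a * t q Wq) /t /loc_cst fracM.
by rewrite -[RHS]/(1 : loc q) frac1; apply: frac_eq_mul; ring.
Qed.

Section Characterization.
Variables (A B : comPzRingType) (F : morphism (Spec B) (Spec A)).
Variable phi : {rmorphism A -> B}.
Hypothesis F_cst : forall a,
  comorph F (topO A) (spec_cst (topO A) a) = spec_cst (preim_mor F (topO A)) (phi a).

Let comorph_cst (V : opens (spec A)) a :
  comorph F V (spec_cst V a) = spec_cst (preim_mor F V) (phi a).
Proof.
have k : (V : set (spec A)) `<=` topO A by [].
have k' : (preim_mor F V : set (spec B)) `<=` preim_mor F (topO A) by [].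
by rewrite -(res_cst k) (@comorph_res _ _ F (topO A) V k k') F_cst res_cst.
Qed.

(** Primes can be read off the sheaf: [a] lies outside a prime exactly when its germ there is a
    unit, and morphisms both preserve and reflect such units. *)
Let base_contract q : F q = contract phi q.
Proof.
apply: spec_ext => a /=; split; apply: contraPP.
  move=> pa; have T : topO A (F q) by [].
  have := @germ_local _ _ F q (topO A) (spec_cst (topO A) a) T.
  by rewrite F_cst !germ_unit_cst //; apply.
move=> Fa; have T : topO A (F q) by [].
have := @pull_germ_unit _ _ F q (topO A) _ (proj2 (germ_unit_cst a T) Fa).
by rewrite F_cst germ_unit_cst.
Qed.

Lemma Spec_map_char : F =m Spec_map phi.
Proof.
apply: eq_morP => [q|V h s]; first exact: base_contract.
apply: spec_secP => q Uq.
have [a [b [W [Wq hW]]]] := spec_sec_frac s (h q Uq).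
pose O := Opens (@opensI_open A W V).
have k : (O : set (spec A)) `<=` V by move=> r [].
(* Near the point [s] is a / b. The equation s b = a involves [F] only through [phi] on [a] and [b],
   and it determines the germ of the image of [s]. *)
have e : @res (Spec A) _ _ k s * (spec_cst O b : @sec (Spec A) O) = spec_cst O a.
  apply: spec_secP => r [Wr Vr].
  rewrite -[LHS]/(sec_val s _ * loc_cst r b) /=.
  have [rb ->] := hW r Wr (k r (conj Wr Vr)).
  by rewrite /loc_cst fracM; apply: frac_eq_mul; ring.
have Oq : preim_mor F O q by rewrite /= base_contract; split=> //; apply: h Uq.
have k' : (preim_mor F O : set (spec B)) `<=` preim_mor F V by move=> r [].
have {}e := congr1 (comorph F O) e.
rewrite rmorphM /= !comorph_cst (@comorph_res _ _ F V O k k') in e.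
have {}e : sec_val (comorph F V s : spec_sec (preim_mor F V)) (k' q Oq) *
    loc_cst q (phi b) = loc_cst q (phi a) :=
  congr1 (fun s : spec_sec (preim_mor F O) => sec_val s Oq) e.
have [qb es] := hW _ Wq (h q Uq).
rewrite (Prop_irrelevance Uq (k' q Oq)) (@eq_frac B q _ (phi a) (phi b) qb e).
move: es; rewrite (Prop_irrelevance (h q Uq) (h q (k' q Oq))) => es.
by rewrite -[RHS]/(loc_map (sec_val s (h q (k' q Oq)))) es loc_map_frac.
Qed.
End Characterization.

Lemma Spec_map_cst (A B : comPzRingType) (phi : {rmorphism A -> B})
    (U : opens (spec A)) a :
  comorph (Spec_map phi) U (spec_cst U a) =
  spec_cst (preim_mor (Spec_map phi) U) (phi a).
Proof.
apply: spec_secP => p Up.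
rewrite -[LHS]/(loc_map (loc_cst _ a)) /loc_cst loc_map_frac /= /loc_cst.
by apply: frac_eq_mul; rewrite rmorph1.
Qed.

Lemma eq_Spec_map (A B : comPzRingType) (phi psi : {rmorphism A -> B}) :
  phi =1 psi -> Spec_map phi =m Spec_map psi.
Proof. by move=> e; apply: Spec_map_char => a; rewrite Spec_map_cst e. Qed.

Lemma Spec_map_comp (A B C : comPzRingType) (phi : {rmorphism A -> B})
    (psi : {rmorphism B -> C}) :
  Spec_map phi \c Spec_map psi =m Spec_map (psi \o phi).
Proof.
by apply: Spec_map_char => a; rewrite comp_mor_comorph !Spec_map_cst res_cst.
Qed.

Lemma Spec_map_inj (A B : comPzRingType) (phi psi : {rmorphism A -> B}) :
  Spec_map phi =m Spec_map psi -> phi =1 psi.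
Proof.
move=> e a; have k : (preim_mor (Spec_map phi) (topO A) : set (spec B)) `<=`
  preim_mor (Spec_map psi) (topO A) by [].
have := @eq_mor_comorph (Spec B) (Spec A) _ _ (topO A) k (spec_cst _ a) e.
rewrite !Spec_map_cst res_cst.
have [|f fK _] := @spec_cst_bij B (preim_mor (Spec_map phi) (topO A)) => //.
exact: (can_inj fK).
Qed.

Lemma Spec_map_full (A B : comPzRingType) (F : morphism (Spec B) (Spec A)) :
  exists phi : {rmorphism A -> B}, F =m Spec_map phi.
Proof.
pose U : opens (spec B) := preim_mor F (topO A).
have [//|f [fK gK]] := bij_rmorphism (@spec_cst_bij B U _).
pose c : {rmorphism spec_sec (topO A) -> spec_sec U} := comorph F (topO A).
exists (f \o (c \o spec_cst (topO A))); apply: Spec_map_char => a.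
by rewrite -[RHS]/(spec_cst U (f _)) gK.
Qed.

(** * Basic open immersions *)

Section Localization.
Variables (A B : comPzRingType) (phi : {rmorphism A -> B}) (g : A).
(** The three hypotheses say that [phi] is the localization of [A] at the powers of [g], without
    fixing a model of it. *)
Hypothesis g_unit : exists g', phi g * g' = 1.
Hypothesis phi_frac : forall s, exists k a, phi g ^+ k * s = phi a.
Hypothesis phi_ker : forall a, phi a = 0 -> exists k, g ^+ k * a = 0.

Lemma loc_g_notin (q : spec B) : ~ contract phi q g.
Proof.
have [g' e] := g_unit; move=> /= qg; have [_ _ qM q1 _] := pset_prime q.
by apply: q1; rewrite -e mulrC; apply: qM.
Qed.

Lemma notin_loc (q : spec B) s k a : phi g ^+ k * s = phi a ->
  q s <-> contract phi q a.
Proof.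
move=> e /=; rewrite -e; have [_ _ qM _ qP] := pset_prime q.
split; first exact: qM.
case/qP => // qg; exfalso; apply: (@notinX _ q (phi g) k) => //.
exact: loc_g_notin.
Qed.

Lemma contract_inj : injective (contract phi).
Proof.
move=> p q e; apply: spec_ext => s; have [k [a ea]] := phi_frac s.
by rewrite (notin_loc _ ea) (notin_loc q ea) e.
Qed.

Lemma phi_eq a b : phi a = phi b -> exists k, g ^+ k * a = g ^+ k * b.
Proof.
move=> /eqP; rewrite -subr_eq0 -rmorphB => /eqP /phi_ker[k /eqP].
by rewrite mulrBr subr_eq0 => /eqP; exists k.
Qed.

Lemma contract_surj (p : spec A) : ~ p g -> exists q, contract phi q = p.
Proof.
move=> pg; have [p0 pD pM p1 pP] := pset_prime p.
(* The extension of [p] to [B]. It contracts back to [p] because elements with equal images become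
   equal after multiplication by a power of [g], which lies outside [p]. *)
pose Q s := exists k a, phi g ^+ k * s = phi a /\ p a.
have Qphi a : Q (phi a) <-> p a.
  split=> [[k [b [e pb]]]|pa]; last by exists 0%N, a; rewrite expr0 mul1r.
  have [|l el] := @phi_eq (g ^+ k * a) b; first by rewrite rmorphM rmorphXn.
  have : p (g ^+ l * (g ^+ k * a)) by rewrite el; apply: (pM).
  by do 2![case/pP; first by move=> h; case: (@notinX _ p g _ pg h)].
have Qprime : prime_ideal Q.
  split.
  - by rewrite -(rmorph0 phi) Qphi.
  - move=> s t [k [a [ea pa]]] [l [b [eb pb]]].
    exists (k + l)%N, (g ^+ l * a + g ^+ k * b).
    split; last by apply: (pD); apply: (pM).
    by rewrite rmorphD !rmorphM !rmorphXn -ea -eb exprD; ring.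
  - move=> s t [l [b [eb pb]]]; have [k [a ea]] := phi_frac s.
    exists (k + l)%N, (a * b); split; last by apply: (pM).
    by rewrite rmorphM -ea -eb exprD; ring.
  - by rewrite -(rmorph1 phi) Qphi.
  move=> s t [m [c [ec pc]]].
  have [k [a ea]] := phi_frac s; have [l [b eb]] := phi_frac t.
  have : Q (phi (g ^+ m * (a * b))).
    rewrite rmorphM (rmorphM _ a) rmorphXn -ea -eb.
    exists 0%N, (g ^+ (k + l) * c); split; last exact: (pM).
    by rewrite rmorphM -ec rmorphXn exprD; ring.
  move=> /Qphi /pP[h|]; first by case: (@notinX _ p g m pg h).
  by case/pP => h; [left; exists k, a|right; exists l, b].
by exists (Prime Qprime); apply: spec_ext => a; apply: Qphi.
Qed.

Lemma range_contract : range (contract phi) = basic_open g.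
Proof.
apply/seteqP; split=> [_ [q _ <-]|p /= /contract_surj[q <-]].
  exact: loc_g_notin.
by exists q.
Qed.

Lemma contract_open (W : opens (spec B)) : open (contract phi @` W).
Proof.
exists [set c | exists s k a, [/\ (basic_open s : set (spec B)) `<=` W,
  phi g ^+ k * s = phi a & c = g * a]].
apply/seteqP; split=> [_ [q Wq <-]|p].
  have [s qs sW] := basic_open_sub Wq; have [k [a ea]] := phi_frac s.
  exists (g * a); first by exists s, k, a.
  by apply: notinM; [exact: loc_g_notin|move=> /(notin_loc _ ea)].
move=> [_ [s [k [a [sW ea ->]]]] pga].
have [q qp] := contract_surj (notinMr pga).
by exists q => //; apply: sW => /(notin_loc _ ea); rewrite qp; apply: notinMl pga.
Qed.

Lemma loc_map_inj (q : spec B) : injective (@loc_map _ _ phi q).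
Proof.
suff inj0 (z : loc (contract phi q)) : loc_map z = 0 -> z = 0.
  move=> x y e; apply/eqP; rewrite -subr_eq0; apply/eqP/inj0.
  rewrite -[LHS]/((@loc_map _ _ phi q : {rmorphism _ -> _}) (x - y)).
  by rewrite rmorphB /= e subrr.
have [a [b [qb ->]]] := frac_surj z.
rewrite loc_map_frac => /frac_eq0[u qu].
have [k [c ec]] := phi_frac u.
move=> /(congr1 ( *%R (phi g ^+ k))); rewrite mulr0 mulrA ec -rmorphM.
move=> /phi_ker[l el]; apply/frac_eq0; exists (g ^+ l * c); last by rewrite -mulrA.
apply: notinM; first exact/notinX/loc_g_notin.
by move=> /(notin_loc _ ec).
Qed.

(* Clearing denominators: [b / c = phi (a g^l) / phi (d g^k)]. *)
Lemma frac_clear (q : spec B) b c (qc : ~ q c) k a l d :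
  phi g ^+ k * b = phi a -> phi g ^+ l * c = phi d ->
  exists qd : ~ contract phi q (d * g ^+ k),
    frac b qc = @loc_map _ _ phi q (frac (a * g ^+ l) qd).
Proof.
move=> eb ec; have qd : ~ contract phi q (d * g ^+ k).
  apply: notinM; last exact/notinX/loc_g_notin.
  by move=> /(notin_loc _ ec).
exists qd; rewrite loc_map_frac; apply: frac_eq_mul.
by rewrite !rmorphM !rmorphXn -eb -ec; ring.
Qed.

Lemma Spec_map_loc_bij (V : opens (spec A)) :
  (V : set (spec A)) `<=` range (contract phi) ->
  bijective (comorph (Spec_map phi) V).
Proof.
move=> VR; apply: inj_surj_bij => [s t e|t].
  apply: spec_secP => p Vp; have [q _ qp] := VR p Vp; case: _ / qp Vp => Vq.
  apply: (@loc_map_inj q); move: e; set U := preim_opens _ V => e.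
  exact: (congr1 (fun s : spec_sec (U : opens (spec B)) =>
    sec_val s (Vq : (U : opens (spec B)) q)) e).
pose U : opens (spec B) := preim_mor (Spec_map phi) V.
pose t' : spec_sec U := t.
(* Only one [q] lies over [p], but [p] is its contraction only up to an equality; the germ is
   specified by transport along any such equality. *)
have ex (p : spec A) (Vp : V p) : exists y : loc p,
    forall (q : spec B) (e : p = contract phi q) (Uq : U q),
      loc_map (eq_rect p (@loc A) y _ e) = sec_val t' Uq.
  have [q _ qp] := VR p Vp; case: _ / qp Vp => Vq.
  have Uq : U q := Vq.
  have [b [c [qc eq]]] := frac_surj (sec_val t' Uq).
  have [k [a ea]] := phi_frac b; have [l [d ed]] := phi_frac c.
  have [qd ebc] := frac_clear qc ea ed.
  exists (frac (a * g ^+ l) qd) => r e; have er := contract_inj e.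
  case: _ / er e => e Uq'; rewrite (Prop_irrelevance e erefl) /=.
  by rewrite (Prop_irrelevance Uq' Uq) eq ebc.
pose s : germs V := fun p Vp => sval (cid (ex p Vp)).
have sE q (Vq : V (contract phi q)) (Uq : U q) :
    loc_map (s (contract phi q) Vq) = sec_val t' Uq.
  by rewrite /s; case: cid => y /= /(_ q erefl Uq).
have sr : s \in @regular_germs A V.
  apply/asboolP => p Vp; have [q _ qp] := VR p Vp; case: _ / qp Vp => Vq.
  have Uq : U q := Vq.
  have [b [c [W [Wq hW]]]] := spec_sec_frac t' Uq.
  have [k [a ea]] := phi_frac b; have [l [d ed]] := phi_frac c.
  (* The exponents in [frac_clear] do not depend on the point, so one fraction serves on the whole
     image of [W]. *)
  exists (a * g ^+ l), (d * g ^+ k), (Opens (contract_open W)); split.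
    by exists q.
  move=> r [r' Wr' rr'] Vr; case: _ / rr' Vr => Vr.
  have [qc eq] := hW r' Wr' (Vr : U r').
  have [qd ebc] := frac_clear qc ea ed; exists qd.
  by apply: loc_map_inj; rewrite sE eq.
by exists (SpecSec sr); apply: spec_secP => q Uq; apply: sE.
Qed.

Lemma Spec_map_loc_imm : open_imm (Spec_map phi).
Proof.
apply: open_imm_crit; first exact: contract_inj.
  exact: contract_open.
exact: Spec_map_loc_bij.
Qed.

End Localization.

Section BasicOpenImmersion.
Variables (A : comPzRingType) (g : A).

Let D := basic_open g.

Lemma spec_cst_unit : exists g' : spec_sec D, spec_cst D g * g' = 1.
Proof.
pose t : germs D := fun p Dp => frac 1 (Dp : ~ p g).
have tr : t \in @regular_germs A D.
  by apply/asboolP => q Dq; exists 1, g, D; split=> // r Wr Ur; exists Ur.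
exists (SpecSec tr); apply: spec_secP => q Dq.
rewrite -[LHS]/(loc_cst q g * t q Dq) /t /loc_cst fracM.
by rewrite -[RHS]/(1 : loc q) frac1; apply: frac_eq_mul; ring.
Qed.

Lemma spec_cst_frac (s : spec_sec D) :
  exists k a, spec_cst D g ^+ k * s = spec_cst D a.
Proof.
have [//|k [a h]] := @spec_sec_basic_open A D g _ s.
exists k, a; rewrite -rmorphXn; apply: spec_secP => p Dp.
rewrite -[LHS]/(loc_cst p (g ^+ k) * sec_val s Dp) (h p Dp (notinX Dp)).
by rewrite /= /loc_cst fracM; apply: frac_eq_mul; ring.
Qed.

Lemma Spec_basic_open_imm : open_imm (Spec_map (spec_cst D)).
Proof.
apply: (@Spec_map_loc_imm _ _ _ g spec_cst_unit spec_cst_frac) => a.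
exact: spec_cst_eq0.
Qed.

Lemma range_basic_open : range (Spec_map (spec_cst D)) = D.
Proof.
apply: (@range_contract _ _ _ g spec_cst_unit spec_cst_frac) => a.
exact: spec_cst_eq0.
Qed.

End BasicOpenImmersion.

(** * Derivations and smooth coordinates *)

Section Derivations.
Variables (R A : comPzRingType) (rho : {rmorphism R -> A}).

(** The target is an A-algebra, seen as a module through [h]: for a difference of two lifts it is
    the ring into which they lift. *)
Definition derivation (B : comPzRingType) (h : {rmorphism A -> B})
    (D : A -> B) : Prop :=
  [/\ forall a b, D (a + b) = D a + D b,
      forall a b, D (a * b) = h a * D b + h b * D a &
      forall r, D (rho r) = 0].

Definition smooth_ring_map : Prop :=
  forall (B C : comPzRingType) (phi : {rmorphism B -> C}), square_zero phi ->
  forall (u : {rmorphism A -> C}) (v : {rmorphism R -> B}),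
    (forall r, u (rho r) = phi (v r)) ->
    exists h : {rmorphism A -> B},
      (forall a, phi (h a) = u a) /\ (forall r, h (rho r) = v r).

(* The differentials of the [b i] generate the module of differentials. *)
Definition diff_generate m (b : 'I_m -> A) : Prop :=
  forall y, exists c : 'I_m -> A,
    forall (B : comPzRingType) (h : {rmorphism A -> B}) (D : A -> B),
      derivation h D -> D y = \sum_i h (c i) * D (b i).

Section Derivation.
Variables (B : comPzRingType) (h : {rmorphism A -> B}) (D : A -> B).
Hypothesis hD : derivation h D.

Lemma derivationD a b : D (a + b) = D a + D b. Proof. by case: hD. Qed.
Lemma derivationM a b : D (a * b) = h a * D b + h b * D a.
Proof. by case: hD. Qed.
Lemma derivation_base r : D (rho r) = 0. Proof. by case: hD. Qed.

Lemma derivation0 : D 0 = 0.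
Proof. by rewrite -(rmorph0 rho) derivation_base. Qed.

Lemma derivation1 : D 1 = 0.
Proof. by rewrite -(rmorph1 rho) derivation_base. Qed.

Lemma derivationN a : D (- a) = - D a.
Proof.
by apply/eqP; rewrite -addr_eq0 -derivationD addNr derivation0.
Qed.

Lemma derivation_sum (I : Type) (l : seq I) (F : I -> A) :
  D (\sum_(i <- l) F i) = \sum_(i <- l) D (F i).
Proof. exact: (big_morph D derivationD derivation0). Qed.

Lemma derivationX a k : D (a ^+ k) = (h a ^+ k.-1 * D a) *+ k.
Proof.
elim: k => [|[|k] IHk]; first by rewrite expr0 derivation1.
  by rewrite expr1 mulr1n mul1r.
by rewrite exprS derivationM IHk rmorphXn mulrnAr mulrA -exprS /= [RHS]mulrSr.
Qed.

Lemma derivation_frobenius p a : p%:R = 0 :> A -> D (a ^+ p) = 0.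
Proof.
move=> p0; rewrite derivationX -mulr_natr -(rmorph_nat h) p0 rmorph0 mulr0 //.
Qed.

End Derivation.

Lemma frobenius_diff_generate p m (b : 'I_m -> A) : p%:R = 0 :> A ->
  (forall y, exists c : 'I_m -> A, y = \sum_i c i ^+ p * b i) ->
  diff_generate b.
Proof.
move=> p0 hb y; have [c ->] := hb y; exists (fun i => c i ^+ p) => B h D hD.
rewrite (derivation_sum hD); apply: eq_bigr => i _.
by rewrite (derivationM hD) (derivation_frobenius hD) // mulr0 addr0.
Qed.

(** * The square-zero extension that records differentials *)

Section SquareZero.
Variable m : nat.

Definition sqz : Type := (A * 'rV[A]_m)%type.

HB.instance Definition _ := GRing.Zmodule.on sqz.

Let sqz_mul (x y : sqz) : sqz := (x.1 * y.1, x.1 *: y.2 + y.1 *: x.2).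
Let sqz_one : sqz := (1, 0).

Fact sqz_mulA : associative sqz_mul.
Proof.
move=> x y z; congr (_, _); rewrite /= ?mulrA //.
by apply/rowP => i; rewrite !mxE; ring.
Qed.

Fact sqz_mulC : commutative sqz_mul.
Proof. by move=> x y; congr (_, _); rewrite /= 1?mulrC 1?addrC. Qed.

Fact sqz_mul1 : left_id sqz_one sqz_mul.
Proof. by case=> a c; rewrite /sqz_mul /= mul1r scale1r scaler0 addr0. Qed.

Fact sqz_mulDl : left_distributive sqz_mul +%R.
Proof.
move=> x y z; congr (_, _); rewrite /= ?mulrDl //.
by apply/rowP => i; rewrite !mxE; ring.
Qed.

HB.instance Definition _ := GRing.Zmodule_isComPzRing.Build sqz
  sqz_mulA sqz_mulC sqz_mul1 sqz_mulDl.

Variable b : 'I_m -> A.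

Definition computes_diff (x : sqz) : Prop :=
  forall (B : comPzRingType) (h : {rmorphism A -> B}) (D : A -> B),
    derivation h D -> D x.1 = \sum_i h (x.2 0 i) * D (b i).

Definition diff_sqz : {pred sqz} := fun x => `[< computes_diff x >].

Fact diff_sqz_subring : subring_closed diff_sqz.
Proof.
split.
- apply/asboolP => B h D hD; rewrite (derivation1 hD) big1 // => i _.
  by rewrite mxE rmorph0 mul0r.
- move=> x y /asboolP hx /asboolP hy; apply/asboolP => B h D hD.
  rewrite /= (derivationD hD) (derivationN hD) (hx _ _ _ hD) (hy _ _ _ hD).
  by rewrite -sumrB; apply: eq_bigr => i _; rewrite !mxE rmorphB mulrBl.
- move=> x y /asboolP hx /asboolP hy; apply/asboolP => B h D hD.
  rewrite /= (derivationM hD) (hx _ _ _ hD) (hy _ _ _ hD).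
  rewrite !mulr_sumr -big_split; apply: eq_bigr => i _.
  by rewrite !mxE rmorphD !rmorphM /=; ring.
Qed.

HB.instance Definition _ :=
  GRing.isSubringClosed.Build sqz diff_sqz diff_sqz_subring.

Record diff_ring : Type :=
  DiffRing { diff_val : sqz; _ : diff_val \in diff_sqz }.

HB.instance Definition _ := [isSub for diff_val].
HB.instance Definition _ := [Choice of diff_ring by <:].
HB.instance Definition _ := GRing.SubChoice_isSubComPzRing.Build sqz diff_sqz
  diff_ring (subringClosedP _).

Definition diff_fst (x : diff_ring) : A := (diff_val x).1.

Fact diff_fst_zmod : zmod_morphism diff_fst. Proof. by []. Qed.
Fact diff_fst_monoid : monoid_morphism diff_fst. Proof. by []. Qed.

HB.instance Definition _ :=
  GRing.isZmodMorphism.Build diff_ring A diff_fst diff_fst_zmod.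
HB.instance Definition _ :=
  GRing.isMonoidMorphism.Build diff_ring A diff_fst diff_fst_monoid.

Lemma diff_fst_square_zero : diff_generate b -> square_zero diff_fst.
Proof.
move=> hb; split=> [y|x y].
  have [c hc] := hb y.
  have yc : ((y, \row_i c i) : sqz) \in diff_sqz.
    apply/asboolP => B h D hD; rewrite (hc _ _ _ hD) /=.
    by apply: eq_bigr => i _; rewrite mxE.
  by exists (DiffRing yc).
rewrite /= /diff_fst => x0 y0; apply: val_inj.
rewrite -[LHS]/(sqz_mul (diff_val x) (diff_val y)) /sqz_mul x0 y0.
by rewrite mul0r !scale0r addr0.
Qed.

Fact diff_base_subproof r : ((rho r, 0) : sqz) \in diff_sqz.
Proof.
apply/asboolP => B h D hD; rewrite (derivation_base hD) big1 // => i _.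
by rewrite mxE rmorph0 mul0r.
Qed.

Definition diff_base r : diff_ring := DiffRing (diff_base_subproof r).

Fact diff_base_zmod : zmod_morphism diff_base.
Proof.
by move=> r s; apply: val_inj; congr (_, _); rewrite /= ?rmorphB // subr0.
Qed.

Fact diff_base_monoid : monoid_morphism diff_base.
Proof.
split=> [|r s]; apply: val_inj; congr (_, _); rewrite /= ?rmorph1 ?rmorphM //.
by rewrite !scaler0 addr0.
Qed.

HB.instance Definition _ :=
  GRing.isZmodMorphism.Build R diff_ring diff_base diff_base_zmod.
HB.instance Definition _ :=
  GRing.isMonoidMorphism.Build R diff_ring diff_base diff_base_monoid.

(* A section of the square-zero extension [diff_fst] is a projection onto the
   module of differentials from a free module. *)
Lemma smooth_dual_basis : smooth_ring_map -> diff_generate b ->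
  exists E : 'I_m -> A -> A, (forall i, derivation idfun (E i)) /\
    forall (B : comPzRingType) (h : {rmorphism A -> B}) (D : A -> B),
      derivation h D -> forall y, D y = \sum_i h (E i y) * D (b i).
Proof.
move=> sm /diff_fst_square_zero sqz0.
have [//|s [sK s_base]] := sm _ _ diff_fst sqz0 idfun diff_base.
have sK1 a : (diff_val (s a)).1 = a := sK a.
(* The product of [sqz] is the Leibniz rule, so the second components of a ring section are
   derivations; that its values lie in [diff_ring] is the expansion of D y. *)
exists (fun i a => (diff_val (s a)).2 0 i); split=> [i|B h D hD y].
  split=> [a c|a c|r]; last by rewrite s_base /= mxE.
    by rewrite rmorphD mxE.
  rewrite rmorphM -[diff_val _]/(sqz_mul (diff_val (s a)) (diff_val (s c))).
  by rewrite /= !mxE !sK1.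
have /asboolP /(_ _ _ _ hD) := valP (s y).
by rewrite /= sK1.
Qed.

End SquareZero.

Lemma idempotent_minor m (M : 'M[A]_m) (p : spec A) :
  exists z : 'I_m -> bool,
    ~ p (\det (\matrix_(i, j) (if z i then M i j else (1%:M - M) i j))).
Proof.
(* Rows of index less than [k] are already chosen, the others are still those of the identity. The
   determinant starts at 1, and at each row one of the two choices keeps it outside [p]. *)
pose Q (k : nat) (z : 'I_m -> bool) := \matrix_(i, j)
  if (i < k)%N then (if z i then M i j else (1%:M - M) i j) else 1%:M i j.
suff hQ k : (k <= m)%N -> exists z, ~ p (\det (Q k z)).
  have [z hz] := hQ m (leqnn m); exists z; congr (~ p (\det _)): hz.
  by apply/matrixP => i j; rewrite !mxE ltn_ord.
elim: k => [_|k IHk km].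
  exists (fun=> true); have -> : Q 0%N (fun=> true) = 1%:M.
    by apply/matrixP => i j; rewrite !mxE.
  by rewrite det1; apply: notin1.
have [z hz] := IHk (ltnW km); pose i0 := Ordinal km.
pose z' b i := if i == i0 then b else z i.
have e : \det (Q k z) = 1 * \det (Q k.+1 (z' true)) + 1 * \det (Q k.+1 (z' false)).
  apply: (@determinant_multilinear _ _ _ _ _ i0).
  - by apply/rowP => j; rewrite !mxE /z' !eqxx /= ltnn ltnS leqnn; ring.
  - apply/matrixP => i j; rewrite !mxE /z' eq_sym (negPf (neq_lift _ _)).
    have := neq_lift i0 i; rewrite -val_eqE /= ltnS leq_eqVlt eq_sym.
    by move=> /negPf -> .
  apply/matrixP => i j; rewrite !mxE /z' eq_sym (negPf (neq_lift _ _)).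
  have := neq_lift i0 i; rewrite -val_eqE /= ltnS leq_eqVlt eq_sym.
  by move=> /negPf -> .
have [p0 pD _ _ _] := pset_prime p.
have [|h] := pselect (p (\det (Q k.+1 (z' true)))); last by exists (z' true).
move=> h1; exists (z' false) => h2; apply: hz; rewrite e !mul1r; exact: pD.
Qed.

Lemma smooth_coordinates m (b : 'I_m -> A) (p : spec A) :
  smooth_ring_map -> diff_generate b ->
  exists g n (a : 'I_n -> A) (D : 'I_n -> A -> A),
  [/\ ~ p g, forall s, derivation idfun (D s),
      forall s t, D s (a t) = g *+ (s == t) &
      forall (B : comPzRingType) (h : {rmorphism A -> B}) (d : A -> B),
        derivation h d ->
        forall y, h g * d y = \sum_s h (D s y) * d (a s)].
Proof.
move=> sm hb; have [E [dE hE]] := smooth_dual_basis sm hb.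
pose M : 'M[A]_m := \matrix_(k, j) E j (b k).
(* Each [E j] is itself a derivation; expanding E_j b_k by the dual basis formula gives the entries
   of M M. *)
have MM : M *m M = M.
  apply/matrixP => k j; rewrite !mxE (hE _ _ _ (dE j) (b k)).
  by apply: eq_bigr => i _; rewrite !mxE.
have [z] := idempotent_minor M p.
set Q := \matrix_(_, _) _; set g := \det Q => pg.
pose H := \adj Q.
(* Since (1 - M) M = 0, only the rows selected by [z] survive. *)
have QM i j : (Q *m M) i j = if z i then M i j else 0.
  rewrite mxE; under eq_bigr do rewrite [Q i _]mxE.
  case: (z i); first by rewrite -[in RHS]MM [RHS]mxE.
  have : ((1%:M - M) *m M) i j = 0 by rewrite mulmxBl mul1mx MM subrr mxE.
  by rewrite mxE.
(* H Q = g: each g d b_k becomes a combination of the selected d b_i. *)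
have HM k j : \sum_(i | z i) H k i * M i j = g * M k j.
  have := congr1 (fun X : 'M[A]_m => X k j) (mulmxA H Q M).
  rewrite mul_adj_mx mul_scalar_mx mxE [in RHS]mxE => <-.
  rewrite big_mkcond; apply: eq_bigr => i _; rewrite QM.
  by case: (z i); rewrite ?mulr0.
(* Q H = g, read on a selected row, makes the derivations [D] below dual to the selected [b] up to
   the factor [g]. *)
have MH t s : z t -> \sum_k M t k * H k s = g *+ (t == s).
  move=> zt; have := congr1 (fun X : 'M[A]_m => X t s) (mul_mx_adj Q).
  rewrite mxE [in RHS]mxE => <-; apply: eq_bigr => k _.
  by rewrite [Q t k]mxE zt.
pose D s y := \sum_k E k y * H k s.
have dD s : derivation idfun (D s).
  split=> [a c|a c|r].
  - rewrite -big_split; apply: eq_bigr => k _.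
    by rewrite (derivationD (dE k)) mulrDl.
  - rewrite /D !mulr_sumr -big_split; apply: eq_bigr => k _.
    by rewrite (derivationM (dE k)) /=; ring.
  by rewrite /D big1 // => k _; rewrite (derivation_base (dE k)) mul0r.
have EM j k : E j (b k) = M k j by rewrite mxE.
exists g, #|z|, (fun s => b (enum_val s)), (fun s => D (enum_val s)); split=> //.
  move=> s t; rewrite /D; under eq_bigr do rewrite EM.
  by rewrite (MH _ _ (enum_valP t)) eq_sym (inj_eq enum_val_inj).
move=> B h d hd y; rewrite -(big_enum_val (A := z) (fun s => h (D s y) * d (b s))).
have hgb k : h g * d (b k) = \sum_(i | z i) \sum_j h (H k i * M i j) * d (b j).
  rewrite (hE _ _ _ hd (b k)) exchange_big mulr_sumr; apply: eq_bigr => j _.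
  by rewrite EM mulrA -rmorphM -HM rmorph_sum mulr_suml.
transitivity (\sum_k \sum_(i | z i) h (E k y * H k i) * d (b i)).
  rewrite (hE _ _ _ hd y) mulr_sumr; apply: eq_bigr => k _.
  rewrite mulrCA hgb mulr_sumr; apply: eq_bigr => i _.
  (* The sum over j of M i j d b_j folds back to d b_i. *)
  rewrite (hE _ _ _ hd (b i)) !mulr_sumr; apply: eq_bigr => j _.
  by rewrite EM !rmorphM /=; ring.
rewrite exchange_big; apply: eq_bigr => i _.
by rewrite /D rmorph_sum mulr_suml.
Qed.

End Derivations.

(** * Polynomial rings *)

(** An equality rather than an isomorphism: eliminating it replaces [A] in all the data that depend
    on it. *)
Lemma nonzero_ring (A : comPzRingType) : (1 : A) <> 0 ->
  exists A' : comNzRingType, (A' : comPzRingType) = A.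
Proof.
case: A => T c nz; have nzb : (1 : GRing.ComPzRing.Pack c) != 0 by apply/eqP.
pose mx := GRing.PzSemiRing_isNonZero.Build (GRing.ComPzRing.Pack c) nzb.
pose A' : comNzRingType :=
  HB.pack (GRing.ComPzRing.sort (GRing.ComPzRing.Pack c)) mx.
by exists A'.
Qed.

Section Polynomials.
Variables (R : comNzRingType) (n : nat).

Lemma mpoly_rmorph_ext (B : comPzRingType) (k l : {rmorphism mpoly n R -> B}) :
  (forall c, k (mpolyC n c) = l (mpolyC n c)) ->
  (forall i, k (mpolyX R (mnm1 i)) = l (mpolyX R (mnm1 i))) -> k =1 l.
Proof.
move=> kC kX q; rewrite [q]mpolyE !rmorph_sum; apply: eq_bigr => m _.
rewrite -mul_mpolyC !rmorphM kC; congr (_ * _).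
rewrite mpolyXE_id !rmorph_prod; apply: eq_bigr => i _.
by rewrite !rmorphXn kX.
Qed.

Lemma mpoly_eval (A : comPzRingType) (f : {rmorphism R -> A}) (a : 'I_n -> A) :
  (1 : A) <> 0 -> exists k : {rmorphism mpoly n R -> A},
    (forall c, k (mpolyC n c) = f c) /\
    (forall i, k (mpolyX R (mnm1 i)) = a i).
Proof.
move=> nz; have [A' e] := nonzero_ring nz; case: _ / e f a nz => f a _.
exists (mmap f a : {rmorphism _ -> _}); split=> [c|i]; first exact: mmapC.
by rewrite /= mmapX mmap1U.
Qed.

End Polynomials.

(** * Etale coordinates *)

Section EtaleRing.
Variables (R : comNzRingType) (A A' : comPzRingType).
Variables (rho : {rmorphism R -> A}) (loc : {rmorphism A -> A'}) (g : A).
(** With [loc_ext] and [loc_epi], this is the universal property of the localization of [A] at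
    [g]. *)
Hypothesis g_unit : exists g', loc g * g' = 1.
Hypothesis loc_ext : forall (B : comPzRingType) (psi : {rmorphism A -> B}),
  (exists b, psi g * b = 1) ->
  exists k : {rmorphism A' -> B}, forall a, k (loc a) = psi a.
Hypothesis loc_epi : forall (B : comPzRingType) (k l : {rmorphism A' -> B}),
  (forall a, k (loc a) = l (loc a)) -> k =1 l.
Variables (n : nat) (a : 'I_n -> A) (D : 'I_n -> A -> A).
Hypothesis dD : forall s, derivation rho idfun (D s).
Hypothesis Da : forall s t, D s (a t) = g *+ (s == t).
Hypothesis diff_gen : forall (B : comPzRingType) (h : {rmorphism A -> B})
  (d : A -> B), derivation rho h d ->
  forall y, h g * d y = \sum_s h (D s y) * d (a s).
Hypothesis smooth : smooth_ring_map (loc \o rho).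
Variable gam : {rmorphism mpoly n R -> A'}.
Hypothesis gamC : forall c, gam (mpolyC n c) = loc (rho c).
Hypothesis gamX : forall i, gam (mpolyX R (mnm1 i)) = loc (a i).

Section Lifting.
Variables (B C : comPzRingType) (phi : {rmorphism B -> C}).
Hypothesis phi_sqz : square_zero phi.
Variables (u : {rmorphism A' -> C}) (v : {rmorphism mpoly n R -> B}).

Definition ring_lift (k : {rmorphism A' -> B}) : Prop :=
  (forall x, phi (k x) = u x) /\ (forall q, k (gam q) = v q).

(** The difference of two lifts is a derivation vanishing on the coordinates, hence is killed by the
    image of [g], a unit. *)
Lemma etale_ring_uniq (k l : {rmorphism A' -> B}) :
  ring_lift k -> ring_lift l -> k =1 l.
Proof.
move=> [ku kv] [lu lv]; pose d y := l (loc y) - k (loc y).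
have phid y : phi (d y) = 0 by rewrite rmorphB ku lu subrr.
have dd : derivation rho (k \o loc) d.
  split=> [x y|x y|r] /=; first by rewrite /d !rmorphD; ring.
    (* The Leibniz rule for a difference of ring maps fails exactly by d x d y, a product of two
       elements of the kernel. *)
    rewrite -[RHS]addr0 -(phi_sqz.2 _ _ (phid x) (phid y)).
    by rewrite /d !rmorphM; ring.
  by rewrite /d -gamC kv lv subrr.
have [g' gg'] := g_unit.
apply: loc_epi => y; apply/esym/eqP; rewrite -subr_eq0 -/(d y); apply/eqP.
have : k (loc g) * d y = 0.
  rewrite (diff_gen dd) big1 // => s _.
  by rewrite /d -gamX kv lv subrr mulr0.
move=> /(congr1 ( *%R (k g'))); rewrite mulr0 mulrA -rmorphM.
by rewrite [g' * _]mulrC gg' rmorph1 mul1r.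
Qed.

Hypothesis uv : forall q, u (gam q) = phi (v q).

(* Two lifts over R differ by a derivation, and the D s produce the derivation
   with prescribed values on the coordinates. *)
Lemma etale_ring_ex : exists k, ring_lift k.
Proof.
have [|h [hu hR]] := smooth phi_sqz (u := u) (v := v \o mpolyC n (R := R)).
  by move=> r; rewrite /= -gamC uv.
have [g' gg'] := g_unit.
(* The error of the lift [h] at each coordinate, to be corrected by a derivation. *)
pose m s := v (mpolyX R (mnm1 s)) - h (loc (a s)).
have phim s : phi (m s) = 0 by rewrite rmorphB hu -uv gamX subrr.
pose w := h g'; have hw : h (loc g) * w = 1 by rewrite -rmorphM gg' rmorph1.
(* The factor [w] cancels the [g] in [Da], so that d takes the value m t at a t. *)
pose d y := \sum_s w * h (loc (D s y)) * m s.
have phid y : phi (d y) = 0.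
  by rewrite rmorph_sum big1 // => s _; rewrite rmorphM phim mulr0.
have dd : derivation rho (h \o loc) d.
  split=> [x y|x y|r] /=.
  - rewrite /d -big_split; apply: eq_bigr => s _.
    by rewrite (derivationD (dD s)) !rmorphD /=; ring.
  - rewrite /d !mulr_sumr -big_split; apply: eq_bigr => s _.
    by rewrite (derivationM (dD s)) !rmorphD !rmorphM /=; ring.
  rewrite /d big1 // => s _.
  by rewrite (derivation_base (dD s)) !rmorph0 mulr0 mul0r.
pose psi y := h (loc y) + d y.
have psi_zmod : zmod_morphism psi.
  move=> x y; rewrite /psi (derivationD dd) (derivationN dd) !rmorphB /=; ring.
have psi_monoid : monoid_morphism psi.
  split=> [|x y]; first by rewrite /psi (derivation1 dd) !rmorph1 addr0.
  rewrite /psi (derivationM dd) /= -[LHS]addr0.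
  by rewrite -(phi_sqz.2 _ _ (phid x) (phid y)) !rmorphM; ring.
pose psiM : {rmorphism A -> B} := HB.pack psi
  (GRing.isZmodMorphism.Build A B psi psi_zmod)
  (GRing.isMonoidMorphism.Build A B psi psi_monoid).
have [|k hk] := loc_ext (psi := psiM).
  (* The inverse of h g + d g, expanded to first order in d g, whose square is zero. *)
  exists (w - w ^+ 2 * d g); rewrite /= /psi.
  have dg2 := phi_sqz.2 _ _ (phid g) (phid g).
  transitivity (h (loc g) * w + (1 - h (loc g) * w) * (w * d g) -
    w ^+ 2 * (d g * d g)); first by ring.
  by rewrite hw dg2; ring.
exists k; split.
  apply: (@loc_epi _ (phi \o k) u) => y /=.
  by rewrite hk /= /psi rmorphD phid addr0 hu.
apply: (@mpoly_rmorph_ext _ _ _ (k \o gam) v) => [c|t] /=.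
  by rewrite gamC hk /= /psi (derivation_base dd) addr0 [h _]hR.
rewrite gamX hk /= /psi /d (bigD1 t) //= big1 => [|s st].
  rewrite Da eqxx mulr1n addr0 [w * _]mulrC hw mul1r /m; ring.
by rewrite Da (negPf st) mulr0n !rmorph0 mulr0 mul0r.
Qed.

End Lifting.
End EtaleRing.

(** * Charts *)
#[local] Instance eq_mor_equivalence (X Y : ringed_space) :
  RelationClasses.Equivalence (@eq_mor X Y).
Proof.
split; [exact: eq_mor_refl|exact: eq_mor_sym|exact: eq_mor_trans].
Qed.

#[local] Instance comp_mor_proper (X Y Z : ringed_space) :
  Morphisms.Proper (Morphisms.respectful (@eq_mor Y Z)
    (Morphisms.respectful (@eq_mor X Y) (@eq_mor X Z))) (@comp_mor X Y Z).
Proof. by move=> g g' eg f f' ef; apply: comp_mor_eq. Qed.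

Lemma iso_comorph_surj (S T : ringed_space) (G : morphism S T)
    (F : morphism T S) (W : opens T) (t : sec (preim_mor G W)) :
  F \c G =m id_mor S -> G \c F =m id_mor T -> exists s, comorph G W s = t.
Proof.
move=> FG GF.
have WF : (W : set T) `<=` preim_mor F (preim_mor G W).
  by move=> y Wy; rewrite -[preim_mor _ _ _]/(W ((G \c F) y)) GF.1.
have GW : (preim_mor G W : set S) `<=` preim_mor G (preim_mor F (preim_mor G W)).
  by move=> y; apply: WF.
exists (res WF (comorph F _ t)); rewrite (comorph_res WF GW).
have k : (preim_mor (F \c G) (preim_mor G W) : set S) `<=`
  preim_mor (id_mor S) (preim_mor G W).
  by move=> x /=; rewrite -[F (G x)]/((F \c G) x) FG.1.
have k' : (preim_mor G W : set S) `<=` preim_mor (F \c G) (preim_mor G W).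
  by move=> x; apply: GW.
have := congr1 (res k') (@eq_mor_comorph _ _ _ _ (preim_mor G W) k t FG).
rewrite comp_mor_comorph /= !res_res => h.
rewrite (res_irr GW (subset_trans k' (@comp_sub _ _ _ F G (preim_mor G W)))) h.
exact: res_id.
Qed.

(** The surjection [tau] serves to carry generators over p-th powers from the sections over [U] to
    [A]. *)
Lemma affine_chart (X : ringed_space) (U : opens X) : affine_open U ->
  exists (A : comPzRingType) (j : morphism (Spec A) X)
    (tau : {rmorphism sec U -> A}),
  [/\ open_imm j, range j = U & forall y, exists s, tau s = y].
Proof.
move=> [A [F [G [GF FG]]]]; have GI := iso_open_imm FG GF.
exists A, (open_incl U \c G).
pose W : opens (open_subspace U) := preim_mor (open_incl U) U.
pose T : opens (spec A) := preim_mor G W.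
have T_top p : T p by exact: set_mem (valP (G p)).
have [f [fK gK]] := bij_rmorphism (spec_cst_bij T_top).
pose c : {rmorphism sec W -> spec_sec T} := comorph G W.
exists (f \o (c \o comorph (open_incl U) U)); split.
- exact: comp_open_imm (open_incl_imm U) GI.
- apply/seteqP; split=> [_ [p _ <-]|x].
    by rewrite -[X in X _](open_incl_range U); exists (G p).
  rewrite -[X in X x -> _](open_incl_range U) => -[y _ <-]; exists (F y) => //=.
  by rewrite -[G (F y)]/((G \c F) y) GF.1.
move=> y; have [t et] := @iso_comorph_surj _ _ G F W (spec_cst T y) FG GF.
have k : (U : set X) `<=` opens_val W by move=> x Ux; exists (SigSub (mem_set Ux)).
exists (res k (t : sec (opens_val W))) => /=.
rewrite -[RHS](fK y); congr (f _); apply: etrans et; congr (comorph G W _).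
by rewrite res_res; exact: (@res_id X (opens_val W) _ t).
Qed.

(** Every prime contains the kernel, since its elements have square zero. *)
Lemma square_zero_contract (B C : comPzRingType) (phi : {rmorphism B -> C}) :
  square_zero phi -> forall q : spec B, exists c, contract phi c = q.
Proof.
move=> [phi_surj phi_sq] q; have [q0 qD qM q1 qP] := pset_prime q.
pose K y := exists b, phi b = y /\ q b.
have qK b : K (phi b) <-> q b.
  split=> [[b' [e qb']]|]; last by exists b.
  have e0 : phi (b - b') = 0 by rewrite rmorphB e subrr.
  have qbb : q (b - b').
    have : q ((b - b') * (b - b')) by rewrite phi_sq.
    by case/qP.
  by rewrite -(subrK b' b); apply: qD.
have Kp : prime_ideal K.
  split.
  - by rewrite -(rmorph0 phi) qK.
  - move=> x y [b [<- qb]] [c [<- qc]]; rewrite -rmorphD qK; exact: qD.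
  - move=> x y [c [<- qc]]; have [b <-] := phi_surj x.
    by rewrite -rmorphM qK; apply: qM.
  - by rewrite -(rmorph1 phi) qK.
  move=> x y; have [b <-] := phi_surj x; have [c <-] := phi_surj y.
  by rewrite -rmorphM !qK; apply: qP.
by exists (Prime Kp); apply: spec_ext => b; apply: qK.
Qed.

(** A lift into [X] automatically lands in the chart, because the thickening has the same points as
    the closed subscheme. *)
Lemma chart_smooth (X Y : ringed_space) (f : morphism X Y)
    (R A : comPzRingType) (rho : {rmorphism R -> A})
    (j : morphism (Spec A) X) (i : morphism (Spec R) Y) :
  formally_smooth f -> open_imm j -> open_imm i ->
  i \c Spec_map rho =m f \c j -> smooth_ring_map rho.
Proof.
move=> f_smooth jI iI ij B C phi sq u v uv.
have [|h [hu hv]] := f_smooth B C phi sq (j \c Spec_map u) (i \c Spec_map v).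
  rewrite -comp_morA -ij !comp_morA !Spec_map_comp.
  by apply: comp_eq_morr; apply: eq_Spec_map => r /=; rewrite uv.
have [|k hk] := open_imm_lift jI (h := h).
  move=> q; have [c <-] := square_zero_contract sq q.
  exists (Spec_map u c) => //.
  by rewrite -[RHS]/((h \c Spec_map phi) c) hu.1.
have [k' kk'] := Spec_map_full k; rewrite kk' in hk.
exists k'; split.
  apply: (@Spec_map_inj _ _ (phi \o k') u); apply: (open_imm_mono jI).
  by rewrite -Spec_map_comp -comp_morA hk.
apply: (@Spec_map_inj _ _ (k' \o rho) v); apply: (open_imm_mono iI).
by rewrite -Spec_map_comp -comp_morA ij comp_morA hk.
Qed.

Section BasicOpen.
Variables (A : comPzRingType) (g : A).
Let loc : {rmorphism A -> spec_sec (basic_open g)} := spec_cst (basic_open g).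

(** If psi g is a unit, no prime in the image of [Spec_map psi] contains [g], so this morphism
    factors through D(g). *)
Lemma basic_open_ext (B : comPzRingType) (psi : {rmorphism A -> B}) :
  (exists b, psi g * b = 1) ->
  exists k : {rmorphism spec_sec (basic_open g) -> B},
    forall a, k (loc a) = psi a.
Proof.
move=> [b e].
have [|k hk] := open_imm_lift (Spec_basic_open_imm g) (h := Spec_map psi).
  move=> q; rewrite range_basic_open /= => qg.
  have [_ _ qM q1 _] := pset_prime q.
  by apply: q1; rewrite -e mulrC; apply: qM.
have [k' kk'] := Spec_map_full k; rewrite kk' in hk.
exists k'; apply: (@Spec_map_inj _ _ (k' \o loc) psi).
by rewrite -Spec_map_comp.
Qed.

Lemma basic_open_epi (B : comPzRingType)
    (k l : {rmorphism spec_sec (basic_open g) -> B}) :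
  (forall a, k (loc a) = l (loc a)) -> k =1 l.
Proof.
move=> e; apply: Spec_map_inj; apply: (open_imm_mono (Spec_basic_open_imm g)).
by rewrite !Spec_map_comp; apply: eq_Spec_map.
Qed.

End BasicOpen.

(** The denominator is made a p-th power: a / g^k = g^((p-1)k) a / g^(pk). *)
Lemma frobenius_generate_basic_open (A : comPzRingType) (g : A) (p m : nat)
    (b : 'I_m -> A) : (0 < p)%N ->
  (forall y, exists c : 'I_m -> A, y = \sum_i c i ^+ p * b i) ->
  forall y : spec_sec (basic_open g), exists c : 'I_m -> spec_sec (basic_open g),
    y = \sum_i c i ^+ p * spec_cst (basic_open g) (b i).
Proof.
move=> p0 hb y; have [g' gg'] := spec_cst_unit g.
have [k [a ea]] := spec_cst_frac y; have [c ec] := hb (g ^+ (p.-1 * k) * a).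
pose loc : {rmorphism A -> spec_sec (basic_open g)} := spec_cst (basic_open g).
have {}ea : loc g ^+ k * y = loc a := ea.
exists (fun i => g' ^+ k * loc (c i)).
transitivity (g' ^+ (p * k) * loc (g ^+ (p.-1 * k) * a)).
  rewrite rmorphM rmorphXn /= -ea -{1}(prednK p0) mulSn.
  transitivity ((loc g * g') ^+ (k + p.-1 * k) * y).
    by rewrite gg' expr1n mul1r.
  by rewrite exprMn !exprD; ring.
rewrite ec rmorph_sum mulr_sumr; apply: eq_bigr => i _.
by rewrite rmorphM rmorphXn /= exprMn -exprM [(p * k)%N]mulnC mulrA.
Qed.

(** Full faithfulness of Spec turns lifting problems for morphisms into those for ring maps, once
    [kap] is inverted. *)
Lemma etale_Spec_map (U : ringed_space) (M A : comPzRingType)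
    (gam : {rmorphism M -> A}) (kap : morphism U (Spec A)) :
  is_iso kap ->
  (forall (B C : comPzRingType) (phi : {rmorphism B -> C}), square_zero phi ->
    forall (u : {rmorphism A -> C}) (v : {rmorphism M -> B}),
    (forall q, u (gam q) = phi (v q)) ->
    exists2 k : {rmorphism A -> B},
      (forall x, phi (k x) = u x) /\ (forall q, k (gam q) = v q) &
      forall l : {rmorphism A -> B},
        (forall x, phi (l x) = u x) /\ (forall q, l (gam q) = v q) -> l =1 k) ->
  formally_etale (Spec_map gam \c kap).
Proof.
move=> [kap' [k'k kk']] et B C phi sq u v uv.
have [u' eu] := Spec_map_full (kap \c u); have [v' ev] := Spec_map_full v.
have e q : u' (gam q) = phi (v' q).
  apply: (@Spec_map_inj _ _ (u' \o gam) (phi \o v')).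
  by rewrite -!Spec_map_comp -eu -ev -comp_morA.
have [k [ku kv] k_uniq] := et B C phi sq u' v' e.
exists (kap' \c Spec_map k).
  split.
    rewrite comp_morA Spec_map_comp -[X in _ =m X]comp_id_mor -k'k comp_morA.
    by rewrite eu; apply: comp_eq_morr; apply: eq_Spec_map.
  rewrite comp_morA -(comp_morA kap) kk' comp_id_mor Spec_map_comp ev.
  exact: eq_Spec_map.
move=> h [hu hv]; have [l el] := Spec_map_full (kap \c h).
have lk : l =1 k.
  apply: k_uniq; split.
    apply: (@Spec_map_inj _ _ (phi \o l) u').
    by rewrite -Spec_map_comp -el comp_morA hu eu; reflexivity.
  apply: (@Spec_map_inj _ _ (l \o gam) v').
  by rewrite -Spec_map_comp -el -comp_morA hv.
by rewrite -[h]comp_id_mor -k'k comp_morA el; apply/comp_eq_morr/eq_Spec_map.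
Qed.

Lemma spec_nonzero (A : comPzRingType) (q : spec A) : (1 : A) <> 0.
Proof. by have [q0 _ _ q1 _] := pset_prime q; move=> e; apply: q1; rewrite e. Qed.

(** The affine open set supplied by F-finiteness need not lie in [W]; a basic open subset does, and
    generation over p-th powers survives localization. *)
Lemma F_finite_chart (p : nat) (p_prime : prime p) (X : ringed_space)
    (aX : morphism X (Spec 'F_p)) (x : X) (W : opens X) :
  F_finite p_prime aX -> W x ->
  exists (A : comPzRingType) (j : morphism (Spec A) X) (q : spec A) m
    (b : 'I_m -> A),
  [/\ open_imm j, range j `<=` W, j q = x, p%:R = 0 :> A &
      forall y, exists c : 'I_m -> A, y = \sum_i c i ^+ p * b i].
Proof.
move=> ff Wx; have [U [Ux Uaff _ [m [b hb]]]] := ff x.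
have [A [j [tau [jI jU tau_surj]]]] := affine_chart Uaff.
have [q0 _ jq0] : range j x by rewrite jU.
have [g qg gW] : exists2 g, ~ q0 g &
    (basic_open g : set (spec A)) `<=` preim_mor j W.
  by apply: basic_open_sub; rewrite /= jq0.
exists (spec_sec (basic_open g)), (j \c Spec_map (spec_cst (basic_open g))).
have [q _ qq0] : range (Spec_map (spec_cst (basic_open g))) q0.
  by rewrite range_basic_open.
pose fX := absolute_frobenius p_prime (Fp_scheme_char p_prime aX).
have k : (U : set X) `<=` preim_mor fX U by [].
pose b' i := res k (b i).
exists q, m, (fun i => spec_cst (basic_open g) (tau (b' i))); split.
- exact: comp_open_imm jI (Spec_basic_open_imm g).
- move=> _ [r _ <-]; apply: gW.
  by rewrite -range_basic_open; exists r.
- by rewrite -jq0 -qq0.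
- rewrite -(rmorph_nat (spec_cst (basic_open g))) -(rmorph_nat tau).
  by rewrite (Fp_scheme_char p_prime aX) !rmorph0.
apply: (@frobenius_generate_basic_open A g p m (fun i => tau (b' i))).
  exact: prime_gt0.
move=> y; have [s <-] := tau_surj y.
have [c /(congr1 (res k)) ec] := hb (res (@idfun_sub X U) s).
exists (fun i => tau (c i)).
rewrite -[s](res_id (@subset_refl _ U)).
have -> : res (@subset_refl _ U) s = res k (res (@idfun_sub X U) s).
  by rewrite res_res; apply: res_irr.
rewrite ec !rmorph_sum; apply: eq_bigr => i _.
rewrite !rmorphM -rmorphXn; congr (tau _ * _).
by rewrite /= /frob_comorph res_res; apply: res_id.
Qed.

Theorem corollary5p6 (p : nat) (p_prime : prime p)
    (X Y : ringed_space) (X_scheme : is_scheme X) (Y_scheme : is_scheme Y)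
    (aX : morphism X (Spec 'F_p)) (aY : morphism Y (Spec 'F_p))
    (X_noetherian : locally_noetherian X) (Y_noetherian : locally_noetherian Y)
    (X_Ffinite : F_finite p_prime aX) (Y_Ffinite : F_finite p_prime aY)
    (f : morphism X Y) (f_Fp : eq_mor (comp_mor aY f) aX)
    (f_smooth : formally_smooth f)
    (x : X) (V : opens Y) (V_affine : affine_open V) (Vfx : V (f x)) :
  exists (n : nat) (U : opens X) (fUV : forall z : X, U z -> V (f z))
    (E : ringed_space) (pi : morphism E (open_subspace V))
    (g : morphism (open_subspace U) E),
    [/\ U x, affine_open U, is_affine_space n pi, formally_etale g &
        eq_mor (comp_mor pi g) (restrict_mor fUV)].
Proof.
have [A [j [q [m [b [jI jV jq Ap hb]]]]]] :=
  F_finite_chart (W := preim_mor f V) X_Ffinite Vfx.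
have [R [i [_ [iI iV _]]]] := affine_chart V_affine.
have [r _ ir] : range i (f x) by rewrite iV.
(* A prime of [R] lies over f x, so [R] is nonzero and its polynomial ring is available. *)
have [R' eR] := nonzero_ring (spec_nonzero r).
case: _ / eR i iI iV r ir => i iI iV r ir {R}; rename R' into R.
have [|k hk] := open_imm_lift iI (h := f \c j).
  by move=> t; rewrite iV; apply: jV; exists t.
have [rho krho] := Spec_map_full k; rewrite {}krho in hk.
have rho_smooth := chart_smooth f_smooth jI iI hk.
have rho_gen := frobenius_diff_generate rho Ap hb.
have [g [n [a [D [qg dD Da genD]]]]] := smooth_coordinates q rho_smooth rho_gen.
pose loc : {rmorphism A -> spec_sec (basic_open g)} := spec_cst (basic_open g).
have jI' : open_imm (j \c Spec_map loc).
  exact: comp_open_imm jI (Spec_basic_open_imm g).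
have ij' : i \c Spec_map (loc \o rho) =m f \c (j \c Spec_map loc).
  by rewrite -Spec_map_comp -!comp_morA hk; reflexivity.
(* The étale lifting argument lifts maps out of the localization of [A]; its smoothness over [R] is
   again read off [f], on the smaller chart. *)
have loc_smooth := chart_smooth f_smooth jI' iI ij'.
pose U := Opens (open_imm_range jI').
have [kap [kap_iso ekap]] := open_imm_iso (U := U) jI' erefl.
have [kV [[e [ekV kVe]] iV']] := open_imm_iso iI iV.
have fUV z : U z -> V (f z).
  by move=> [t _ <-]; apply: jV; exists (Spec_map loc t).
have [t _ tq] : range (Spec_map loc) q by rewrite range_basic_open.
have [gam [gamC gamX]] := mpoly_eval (loc \o rho) (loc \o a) (spec_nonzero t).
exists n, U, fUV, (Spec (mpoly n R)), (e \c Spec_map (mpolyC n (R := R))).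
exists (Spec_map gam \c kap); split.
- by exists t => //; rewrite -jq -tq.
- by exists (spec_sec (basic_open g)), kap.
- exists R, e, (id_mor _); split.
  + by exists kV.
  + by exists (id_mor _); split; apply: comp_id_mor.
  + by rewrite comp_mor_id; reflexivity.
- apply: etale_Spec_map => // B C phi sq u v uv.
  have gu := spec_cst_unit g.
  have [l hl] := etale_ring_ex gu (@basic_open_ext A g) (@basic_open_epi A g)
    dD Da loc_smooth gamC gamX sq uv.
  exists l => // l' hl'.
  exact: (etale_ring_uniq gu (@basic_open_epi A g) genD gamC gamX sq hl' hl).
(* The two morphisms into [V] may be compared in [Y], where both become [f] restricted to [U]. *)
apply: (open_imm_mono (open_incl_imm V)); rewrite open_incl_restrict.
have ie : open_incl V \c e =m i.
  by rewrite -iV' comp_morA kVe comp_mor_id; reflexivity.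
rewrite -!comp_morA ie -ekap -[X in _ =m X]comp_morA -ij'.
rewrite (comp_morA i) Spec_map_comp; apply: comp_eq_morl; apply: comp_eq_morr.
exact: eq_Spec_map.
Qed.
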